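(* Let $\mathbf{G}=(J,\mu,E)$ be a graphing and $F\subseteq E$ a Borel subset of edges. The following are equivalent: (i) $(J,\mu,F)$ is a hyperfinite forest; (ii) $F$ is a Borel subset of the edge set of a hyperfinite essential spanning forest of $\mathbf{G}$; (iii) $\rho_{\mathbf{G}}(F)=\eta_{\mathbf{G}}(F)$. Similarly, the following are equivalent: (i') $(J,\mu,F)$ is a hyperfinite essential spanning forest of $\mathbf{G}$; (ii') $\rho_{\mathbf{G}}(F)=\eta_{\mathbf{G}}(F)=\rho_{\mathbf{G}}(E)$.
   Context: A graphing $\mathbf{G}=(J,\mu,E)$: $(J,\mu)$ a standard Borel probability space, $E\subseteq\binom{J}{2}$ Borel with bounded degrees, satisfying $\int_A\deg(B,x)\,d\mu(x)=\int_B\deg(A,x)\,d\mu(x)$ for all measurable $A,B\subseteq J$ ($\deg(S,x)$ = number of edges from $x$ to $S$). Edge measure: $\eta_{\mathbf{G}}(F)=\frac12\int_J\deg_F(x)\,d\mu(x)$. Rank: $\rho_{\mathbf{G}}(F)=1-\int_J\frac{1}{|V(\mathbf{G}^F_x)|}\,d\mu(x)$, where $\mathbf{G}^F_x$ is the component of $x$ in $(J,\mu,F)$ and $1/\infty=0$. $(J,\mu,F)$ is hyperfinite if for every $\varepsilon>0$ there is Borel $S\subseteq F$ with $\eta_{\mathbf{G}}(S)\le\varepsilon$ such that all components of $(J,\mu,F\setminus S)$ are finite. A forest is an acyclic edge set; an essential spanning forest of $\mathbf{G}$ is a forest forming a spanning tree in every finite component of $\mathbf{G}$ and having only infinite components inside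 infinite components of $\mathbf{G}$. These notions are understood up to $\eta_{\mathbf{G}}$-null sets. *)

(* Defs.v *)
From HB Require Import structures.
From mathcomp Require Import all_boot all_order all_algebra.
From mathcomp Require Import all_classical all_reals all_analysis.
From mathcomp Require Import finmap.
From Stdlib Require Import Relations.

Set Implicit Arguments.
Unset Strict Implicit.
Unset Printing Implicit Defensive.
Import Order.TTheory GRing.Theory Num.Theory.
Local Open Scope classical_set_scope.
Local Open Scope ring_scope.

(* Edge sets are represented as (ordered, required symmetric) subsets of J * J:
   the unordered edge {x,y} corresponds to both (x,y) and (y,x). *)

(** Standard Borel space: Borel-isomorphic to a Borel subset of the reals
    (Kuratowski); i.e. an injective measurable map onto a Borel set whose
    inverse is measurable (images of measurable sets are measurable). *)
Definition standard_borel (d : measure_display) (J : measurableType d)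
  (R : realType) : Prop :=
  exists f : J -> R,
    injective f /\ measurable_fun setT f /\ measurable (range f) /\
    (forall A : set J, measurable A -> measurable (f @` A)).

Definition sym_edges (T : Type) (F : set (T * T)) : Prop :=
  forall x y, F (x, y) -> F (y, x).

Definition irrefl_edges (T : Type) (F : set (T * T)) : Prop :=
  forall x, ~ F (x, x).

Definition nbhd (T : Type) (F : set (T * T)) (x : T) : set T := [set y | F (x, y)].

Definition deg (T : choiceType) (R : realType) (F : set (T * T)) (S : set T)
  (x : T) : \bar R := counting (S `&` nbhd F x).

Definition graphing (d : measure_display) (J : measurableType d) (R : realType)
  (mu : probability J R) (E : set (J * J)) : Prop :=
  [/\ standard_borel J R,
      [/\ measurable E, sym_edges E & irrefl_edges E],
      (exists D : nat, forall x : J, deg R E setT x <= (D%:R)%:E)%E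
    & forall A B : set J, measurable A -> measurable B ->
        (\int[mu]_(x in A) deg R E B x = \int[mu]_(x in B) deg R E A x)%E].

Definition edge_meas (d : measure_display) (J : measurableType d) (R : realType)
  (mu : probability J R) (F : set (J * J)) : \bar R :=
  ((2^-1)%:E * \int[mu]_x deg R F setT x)%E.

Definition connected (T : Type) (F : set (T * T)) : relation T :=
  clos_refl_trans T (fun a b => F (a, b)).

Definition component (T : Type) (F : set (T * T)) (x : T) : set T :=
  [set y | connected F x y].

Definition inv_size (T : choiceType) (R : realType) (A : set T) : \bar R :=
  if `[< finite_set A >] then (((#|` fset_set A|)%fset%:R)^-1 : R)%:E else 0%E.

Definition grank (d : measure_display) (J : measurableType d) (R : realType)
  (mu : probability J R) (F : set (J * J)) : \bar R :=
  (1 - \int[mu]_x inv_size R (component F x))%E.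

Definition is_cycle (T : Type) (F : set (T * T)) (n : nat) (f : nat -> T) : Prop :=
  [/\ (3 <= n)%N,
      (forall i j, (i < n)%N -> (j < n)%N -> f i = f j -> i = j)
    & forall i, (i < n)%N -> F (f i, f (i.+1 %% n)%N)].

Definition acyclic (T : Type) (F : set (T * T)) : Prop :=
  forall n f, ~ is_cycle F n f.

Definition forest (d : measure_display) (J : measurableType d) (R : realType)
  (mu : probability J R) (F : set (J * J)) : Prop :=
  exists N : set (J * J),
    [/\ measurable N, sym_edges N, N `<=` F, edge_meas mu N = 0%E
      & acyclic (F `\` N)].

Definition hyperfinite (d : measure_display) (J : measurableType d) (R : realType)
  (mu : probability J R) (F : set (J * J)) : Prop :=
  forall eps : R, 0 < eps ->
    exists S : set (J * J),
      [/\ measurable S, sym_edges S, S `<=` F, (edge_meas mu S <= eps%:E)%E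
        & forall x, finite_set (component (F `\` S) x)].

Definition ess_spanning_forest (d : measure_display) (J : measurableType d)
  (R : realType) (mu : probability J R) (E F : set (J * J)) : Prop :=
  [/\ F `<=` E, forest mu F &
      {ae mu, forall x,
         (finite_set (component E x) -> component F x = component E x) /\
         (~ finite_set (component E x) -> ~ finite_set (component F x))}].

(* Main.v *)
Require Import Defs.
From HB Require Import structures.
From mathcomp Require Import finmap.
From mathcomp Require Import all_boot all_order all_algebra.
From mathcomp Require Import all_classical all_reals all_analysis.
From mathcomp Require Import measurable_realfun ring lra.
From Stdlib Require Import Relations.

Set Implicit Arguments.
Unset Strict Implicit.
Unset Printing Implicit Defensive.
Import Order.TTheory GRing.Theory Num.Theory.
Local Open Scope classical_set_scope.
Local Open Scope ring_scope.

(* Everything rests on one construction. By Lusin separation, a Borel graph of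
   bounded degree is a countable union of graphs of Borel partial isomorphisms, and
   the graphing identity makes these measure preserving; hence the mass transport
   principle holds along components, and the integral of 1/|component| is the
   measure of any Borel transversal of the finite components.
   Inside any Borel edge set A, a forest is grown by attaching, in countably many
   stages, finite components to the outside by a single edge each. A stage keeps all
   edges bridges, keeps hyperfiniteness, and raises edge measure and rank by the same
   amount, the measure of the set of attaching vertices. In the limit every finite
   component is a component of A: one gets T with rho(T) = eta(T) = rho(A).
   If rho(F) = eta(F), then growing inside A = F gives eta(F \ T) = 0, so F is a
   hyperfinite forest up to a null set. If F is a forest with finite components, then
   T = F because all edges of F are bridges, so rho(F) = eta(F), and a hyperfinite
   forest is almost everywhere an increasing union of such forests. Growing inside E
   from a given hyperfinite forest yields the essential spanning forest. *)

(** * Definability of measurable sets *)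

(** The obstacle throughout is measurability: a set defined by quantifying over points of [J] is in
    general only analytic. Quantifiers over points are therefore confined to components of [E],
    where they turn into quantifiers over the index of a partial isomorphism. Separation is proved
    in the Cantor space, where finite initial segments do all the work, and is carried over to [J]
    by a Borel code. The edges to attach must be selected without any choice. Two cylinders of the
    code single out at most one edge leaving each finite component. There are countably many pairs
    of cylinders, and each pair recurs infinitely often because the components change from stage to
    stage. Edge sets consist of ordered pairs, so an attached edge counts twice in the integral of
    the degree. The factor one half in the edge measure is what makes its increment equal to that of
    the rank. Acyclicity is replaced by the condition that every edge is a bridge, a statement about
    reachability that can be proved by induction along paths. *)

Section definability.
Context (d : measure_display) (T : measurableType d).
Implicit Types P Q : T -> Prop.

Lemma msetA P Q : measurable [set x | P x] -> measurable [set x | Q x] ->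
  measurable [set x | P x /\ Q x].
Proof. exact: measurableI. Qed.

Lemma msetO P Q : measurable [set x | P x] -> measurable [set x | Q x] ->
  measurable [set x | P x \/ Q x].
Proof. exact: measurableU. Qed.

Lemma msetN P : measurable [set x | P x] -> measurable [set x | ~ P x].
Proof. exact: measurableC. Qed.

Lemma msetI P Q : measurable [set x | P x] -> measurable [set x | Q x] ->
  measurable [set x | P x -> Q x].
Proof.
move=> mP mQ; rewrite (_ : mkset _ = [set x | ~ P x \/ Q x]).
  by apply: msetO => //; exact: msetN.
apply/seteqP; split=> x /= PQ; last by case: PQ.
by have [Px|nPx] := pselect (P x); [right; exact: PQ|left].
Qed.

Lemma mset_cst (P : Prop) : measurable [set _ : T | P].
Proof.
have [p|np] := pselect P.
  by rewrite (_ : mkset _ = setT)//; apply/seteqP; split.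
by rewrite (_ : mkset _ = set0)//; apply/seteqP; split.
Qed.

Lemma mset_ex (I : countType) (P : I -> T -> Prop) :
  (forall i, measurable [set x | P i x]) ->
  measurable [set x | exists i, P i x].
Proof.
move=> mP; rewrite (_ : mkset _ = \bigcup_i [set x | P i x]).
  by apply: countable_bigcupT_measurable => //; exact: countableP.
by apply/seteqP; split => x /=; [case=> i Pi; exists i|case=> i _ Pi; exists i].
Qed.

Lemma mset_all (I : countType) (P : I -> T -> Prop) :
  (forall i, measurable [set x | P i x]) ->
  measurable [set x | forall i, P i x].
Proof.
move=> mP; rewrite (_ : mkset _ = [set x | ~ exists i, ~ P i x]).
  by apply: msetN; apply: mset_ex => i; exact: msetN.
by apply/seteqP; split=> x /=; [move=> h [i]; apply; exact: h|move=> h i; apply: contrapT => n; apply: h; exists i].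
Qed.

Lemma mset_pre (d' : measure_display) (U : measurableType d') (f : T -> U)
    (A : U -> Prop) :
  measurable_fun setT f -> measurable [set u | A u] ->
  measurable [set x | A (f x)].
Proof. by move=> mf mA; rewrite -[mkset _]setTI; exact: mf. Qed.

End definability.

Lemma mset_mfun (d d' : measure_display) (T : measurableType d)
    (U : measurableType d') (f : T -> U) :
  (forall A, measurable A -> measurable [set x | A (f x)]) ->
  measurable_fun setT f.
Proof. by move=> h _ A mA; rewrite setTI; exact: h. Qed.

(** * Analytic subsets of the Cantor space *)

Definition cylinders : set (set (nat -> bool)) :=
  [set A | exists n, A = [set z : nat -> bool | z n]].

Definition cantorM := g_sigma_algebraType cylinders.

Lemma measurable_coord n : measurable [set z : cantorM | z n].
Proof. by apply: sub_sigma_algebra; exists n. Qed.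

Lemma measurable_fun_cantor (d : measure_display) (T : measurableType d)
    (f : T -> cantorM) :
  (forall n, measurable [set x | f x n]) -> measurable_fun setT f.
Proof.
move=> mf; have E : @measurable _ cantorM = <<s cylinders >> by [].
have H : preimage_set_system setT f cylinders `<=` measurable.
  by move=> _ [_ [n ->] <-]; rewrite setTI; exact: mf.
exact: measurability E H.
Qed.

Definition agree (T : Type) n (u v : nat -> T) := forall i, (i < n)%N -> u i = v i.

Lemma agreeW (T : Type) m n (u v : nat -> T) :
  (m <= n)%N -> agree n u v -> agree m u v.
Proof. by move=> mn uv i im; apply: uv; exact: leq_trans mn. Qed.

(** Closedness in the product of the Cantor space and the Baire space, in terms of initial segments,
    so that a point of [C] can be built digit by digit. *)
Definition seq_closed (C : (nat -> bool) -> (nat -> nat) -> Prop) :=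
  forall z s, (forall n, exists z' s', [/\ agree n z z', agree n s s' & C z' s']) ->
  C z s.

(** Analytic sets in Suslin's form, as projections along the Baire space of closed sets. *)
Definition analytic (A : set (nat -> bool)) := exists C,
  seq_closed C /\ forall z, A z <-> exists s, C z s.

Lemma analytic_coord n b : analytic [set z | z n = b].
Proof.
exists (fun z _ => z n = b); split => [z s /(_ n.+1)[z' [s' [zz' _ <-]]]|z].
  exact: zz'.
by split=> [|[]//] zn; exists (fun=> 0%N).
Qed.

(** The first digit of the witness names a member of the union, the remaining digits witness
    membership in it. *)
Lemma analytic_bigcup (A : nat -> set (nat -> bool)) :
  (forall i, analytic (A i)) -> analytic (\bigcup_i A i).
Proof.
move=> /choice[C CA].
exists (fun z s => C (s 0%N) z (fun n => s n.+1)); split=> [z s h|z].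
  apply: (CA (s 0%N)).1 => n; have [z' [s' [zz' ss' Cz']]] := h n.+1.
  exists z', (fun n => s' n.+1); split.
  - by apply: agreeW zz'.
  - by move=> i il; apply: ss'.
  - by rewrite ss'.
split=> [[i _ /(CA i).2[s Cs]]|[s Cs]].
  by exists (fun n => if n is n'.+1 then s n' else i).
by exists (s 0%N) => //; apply/(CA _).2; eexists; exact: Cs.
Qed.

(** A single sequence stores the witnesses for all members, the [i]-th one at the places
    [pickle (i, n)]. *)
Lemma analytic_bigcap (A : nat -> set (nat -> bool)) :
  (forall i, analytic (A i)) -> analytic (\bigcap_i A i).
Proof.
move=> /choice[C CA].
exists (fun z s => forall i, C i z (fun n => s (pickle (i, n)))).
split=> [z s h i|z].
  apply: (CA i).1 => n.
  (* [N] lies beyond the places of the first [n] digits of the [i]-th witness, so agreement below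
     [N] controls these digits. *)
  pose N := maxn n (\max_(k < n) (pickle (i, k : nat)).+1).
  have [z' [s' [zz' ss' Cz']]] := h N.
  exists z', (fun n => s' (pickle (i, n))); split.
  - by apply: agreeW zz'; exact: leq_maxl.
  - move=> k kn; apply: ss'; apply: leq_trans (leq_maxr _ _).
    by rewrite (bigD1 (Ordinal kn))//= leq_max leqnn.
  - exact: Cz'.
split=> [Az|[s Cs] i _]; last by apply/(CA i).2; eexists; exact: Cs.
have /choice[s Cs] : forall i, exists s, C i z s.
  by move=> i; apply/(CA i).2; exact: Az.
pose S n := if unpickle n is Some (i, k) then s i k else 0%N.
exists S => i; suff -> : (fun n => S (pickle (i, n))) = s i by exact: Cs.
by apply/funext => n; rewrite /S pickleK.
Qed.

(** Analytic sets are not closed under complement, so the induction carries the complement along: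
    sets analytic together with their complement form a sigma-algebra. *)
Lemma measurable_analytic (B : set cantorM) : measurable B -> analytic B.
Proof.
suff : measurable `<=` [set A : set cantorM | analytic A /\ analytic (~` A)].
  by move=> h /h[].
apply: smallest_sub; last first.
  move=> _ [n ->]; split; first exact: analytic_coord.
  rewrite (_ : ~` _ = [set z : nat -> bool | z n = false]).
    exact: analytic_coord.
  by apply/seteqP; split => z /=; [move/negP/negbTE|move=> ->].
have a0 : analytic set0.
  (* Contradictory demands on digit 0: true for [i = 0], false for every other [i]. *)
  rewrite (_ : set0 = \bigcap_i [set z : nat -> bool | z 0%N = (i == 0%N)]).
    by apply: analytic_bigcap => i; exact: analytic_coord.
  apply/seteqP; split=> // z h.
  by have /= := h 0%N I; have /= -> := h 1%N I.
have aT : analytic setT.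
  by exists (fun _ _ => True); split=> // z; split=> // _; exists (fun=> 0%N).
split; first by split=> //; rewrite setC0.
  by move=> A [aA aCA]; rewrite setTD; split=> //; rewrite setCK.
move=> F h; split; first by apply: analytic_bigcup => i; exact: (h i).1.
by rewrite setC_bigcup; apply: analytic_bigcap => i; exact: (h i).2.
Qed.

Definition interleave (x y : nat -> bool) : nat -> bool :=
  fun n => if odd n then y n./2 else x n./2.

Definition evens (z : nat -> bool) : nat -> bool := fun n => z n.*2.
Definition odds (z : nat -> bool) : nat -> bool := fun n => z n.*2.+1.

Lemma evens_interleave x y : evens (interleave x y) = x.
Proof. by apply/funext => n; rewrite /evens /interleave odd_double doubleK. Qed.

Lemma odds_interleave x y : odds (interleave x y) = y.
Proof. by apply/funext => n; rewrite /odds /interleave /= odd_double /= uphalf_double. Qed.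

Lemma interleave_evens_odds z : interleave (evens z) (odds z) = z.
Proof.
apply/funext => n; rewrite /interleave /evens /odds.
by rewrite -{4}[n]odd_double_half; case: (odd n).
Qed.

Lemma agree_interleave n x x' y y' :
  agree n x x' -> agree n y y' -> agree n (interleave x y) (interleave x' y').
Proof.
move=> xx yy i il; rewrite /interleave; have h : (i./2 < n)%N.
  by apply: leq_ltn_trans il; rewrite -{2}[i]odd_double_half -addnn addnA leq_addl.
by case: ifP => _; [exact: yy|exact: xx].
Qed.

(** The projected coordinate [y] moves into the witness: its bits sit at the even places, nonzero
    meaning true, and the old witness occupies the odd places. *)
Lemma analytic_proj (A : set (nat -> bool)) : analytic A ->
  analytic [set x | exists y, A (interleave x y)].
Proof.
move=> [C [cC CA]].
exists (fun x s => C (interleave x (fun n => s n.*2 != 0%N)) (fun n => s n.*2.+1)).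
split=> [z s h|z].
  apply: cC => n; have [z' [s' [zz' ss' Cz']]] := h n.*2.+1.
  have dn i : (i < n)%N -> (i.*2.+1 < n.*2.+1)%N.
    by rewrite ltnS ltn_double.
  do 2 eexists; split; last exact: Cz'.
  - apply: agree_interleave.
      by apply: agreeW zz'; rewrite -addnn leqW// leq_addl.
    by move=> i il; rewrite ss'// ltnW// dn.
  - by move=> i il; rewrite ss'// dn.
split=> [[y /CA[s Cs]]|[s Cs]]; last by eexists; apply/CA; eexists; exact: Cs.
exists (fun n => if odd n then s n./2 else nat_of_bool (y n./2)).
set y' := (fun n => _ != _); have -> : y' = y.
  by apply/funext=> n; rewrite /y' odd_double doubleK; case: (y n).
rewrite (_ : (fun n => _) = s)//; apply/funext => n.
by rewrite /= odd_double /= uphalf_double.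
Qed.

Definition borel_separated (A B : set cantorM) :=
  exists M : set cantorM, [/\ measurable M, A `<=` M & B `<=` ~` M].

(** With [M i j] separating [A i] from [B j], the union over [i] of the intersections over [j]
    separates the two unions. *)
Lemma separated_bigcup (I : countType) (A B : I -> set cantorM) :
  (forall i j, borel_separated (A i) (B j)) -> borel_separated (\bigcup_i A i) (\bigcup_i B i).
Proof.
move=> h; pose M' i j := cid (h i j); pose M i j := projT1 (M' i j).
have MP i j : [/\ measurable (M i j), A i `<=` M i j & B j `<=` ~` M i j].
  exact: (projT2 (M' i j)).
exists [set z | exists i, forall j, M i j z]; split.
- by apply: mset_ex => i; apply: mset_all => j; case: (MP i j).
- by move=> z [i _ Az]; exists i => j; case: (MP i j) => _ + _; exact.
- move=> z [j _ Bz] [i /(_ j)]; case: (MP i j) => _ _; exact.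
Qed.

(* If the two sets were not separated, neither would be two of their pieces with
   prescribed initial segments of arbitrary length; the limit of the segments
   would then be a common point. *)
Lemma analytic_separated (A B : set cantorM) : analytic A -> analytic B ->
  A `&` B = set0 -> borel_separated A B.
Proof.
move=> [C [cC CA]] [D [cD DB]] AB0; apply: contrapT => nAB.
pose piece K (p : seq (bool * nat)) : set cantorM := [set z | exists s,
  K z s /\ forall i, (i < size p)%N -> (z i, s i) = nth (false, 0%N) p i].
have pieceS K p : piece K p = \bigcup_a piece K (rcons p a).
  apply/seteqP; split=> [z [s [Ks sp]]|z [a _ [s [Ks sp]]]].
    exists (z (size p), s (size p)) => //; exists s; split=> // i.
    rewrite size_rcons ltnS nth_rcons leq_eqVlt => /predU1P[->|il].
      by rewrite ltnn eqxx.
    by rewrite il; exact: sp.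
  exists s; split=> // i il; rewrite sp ?size_rcons; last exact: ltnW.
  by rewrite nth_rcons il.
have step (pq : seq (bool * nat) * seq (bool * nat)) : exists ab,
    ~ borel_separated (piece C pq.1) (piece D pq.2) ->
    ~ borel_separated (piece C (rcons pq.1 ab.1)) (piece D (rcons pq.2 ab.2)).
  apply: contrapT => /forallNP h.
  have h' a b : borel_separated (piece C (rcons pq.1 a)) (piece D (rcons pq.2 b)).
    by apply: contrapT => n; apply: (h (a, b)).
  (* The digits are arbitrary here: if all extensions were separated, then so would be the pieces
     themselves, against the premise [n]. *)
  apply: (h ((false, 0%N), (false, 0%N))) => n; exfalso; apply: n.
  by rewrite (pieceS C) (pieceS D); exact: separated_bigcup.
have [f fP] := choice step.
pose st n := iter n (fun pq => (rcons pq.1 (f pq).1, rcons pq.2 (f pq).2)) ([::], [::]).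
have stP n : ~ borel_separated (piece C (st n).1) (piece D (st n).2).
  elim: n => [|n /= IH]; last exact: fP.
  move=> [M [mM AM BM]]; apply: nAB; exists M; split=> // z.
    by move=> /CA[s Cs]; apply: AM; exists s.
  by move=> /DB[s Ds]; apply: BM; exists s.
pose u n := (f (st n)).1; pose v n := (f (st n)).2.
have st1 n : (st n).1 = mkseq u n by elim: n => //= n ->; rewrite mkseqS.
have st2 n : (st n).2 = mkseq v n by elim: n => //= n ->; rewrite mkseqS.
pose z n := (u n).1; pose s n := (u n).2; pose w n := (v n).1; pose t n := (v n).2.
(* An empty set is separated from any other, so both pieces are inhabited at every stage; their
   points are the approximations that closedness asks for. *)
have sep0 n : piece C (st n).1 !=set0 /\ piece D (st n).2 !=set0.
  split; apply/set0P/negP => /eqP E; apply: (stP n); rewrite E.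
    by exists set0; split=> //; rewrite setC0.
  by exists setT; split.
have Czs : C z s.
  apply: cC => n; have [[z' [s' [Cz h]]] _] := sep0 n.
  exists z', s'; rewrite st1 size_mkseq in h.
  by split=> // i il; have := h i il; rewrite nth_mkseq// /z /s => <-.
have Dwt : D w t.
  apply: cD => n; have [_ [z' [s' [Cz h]]]] := sep0 n.
  exists z', s'; rewrite st2 size_mkseq in h.
  by split=> // i il; have := h i il; rewrite nth_mkseq// /w /t => <-.
have zw : z = w.
  apply/funext => n; apply: contrapT => /eqP zwn.
  apply: (stP n.+1); exists [set x : cantorM | x n = z n]; split.
  - have [_|_] := boolP (z n); first exact: measurable_coord.
    rewrite (_ : mkset _ = [set x : cantorM | ~ x n]).
      by apply: msetN; exact: measurable_coord.
    by apply/seteqP; split => x /=; [move=> ->|move=> /negP/negbTE].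
  - move=> x [s' [_ h]] /=; rewrite st1 size_mkseq in h.
    by have := h n (ltnSn _); rewrite nth_mkseq// /z => <-.
  - move=> x [s' [_ h]] /= xz; rewrite st2 size_mkseq in h.
    by have := h n (ltnSn _); rewrite nth_mkseq// => E; move: zwn; rewrite -xz /w -E eqxx.
have : (A `&` B) z by split; [apply/CA; exists s|apply/DB; exists t; rewrite zw].
by rewrite AB0.
Qed.

(** * Coding standard Borel spaces by the Cantor space *)

(** A Borel isomorphism onto a Borel subset of the Cantor space; the last clause expresses
    measurability of the inverse through preimages. *)
Definition coded (d : measure_display) (X : measurableType d) (c : X -> cantorM) :=
  [/\ injective c, measurable_fun setT c, measurable (range c) &
      forall A, measurable A -> exists2 B, measurable B & A = c @^-1` B].

Lemma sigma_algebra_code (X : Type) (c : X -> cantorM) :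
  sigma_algebra setT [set A | exists2 B, measurable B & A = c @^-1` B].
Proof.
split.
- by exists set0.
- move=> _ [B mB ->]; exists (~` B); first exact: measurableC.
  by rewrite preimage_setC setTD.
- move=> A hA; pose B i := s2val (cid2 (hA i)); exists (\bigcup_i B i).
    by apply: bigcupT_measurable => i; exact: (s2valP (cid2 (hA i))).
  rewrite preimage_bigcup; apply: eq_bigcupr => i _.
  exact: (s2valP' (cid2 (hA i))).
Qed.

Lemma measurable_evens : measurable_fun setT (evens : cantorM -> cantorM).
Proof. by apply: measurable_fun_cantor => n; exact: measurable_coord. Qed.

Lemma measurable_odds : measurable_fun setT (odds : cantorM -> cantorM).
Proof. by apply: measurable_fun_cantor => n; exact: measurable_coord. Qed.

Definition pair_code (X Y : Type) (c : X -> cantorM) (e : Y -> cantorM)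
  (p : X * Y) : cantorM := interleave (c p.1) (e p.2).

Lemma coded_prod (d d' : measure_display) (X : measurableType d)
    (Y : measurableType d') (c : X -> cantorM) (e : Y -> cantorM) :
  coded c -> coded e -> coded (pair_code c e).
Proof.
move=> [ic mc rc sc] [ie me re se]; split.
- move=> [x y] [x' y'] E; congr pair.
    by apply: ic; rewrite -(evens_interleave (c x) (e y)) [interleave _ _]E evens_interleave.
  by apply: ie; rewrite -(odds_interleave (c x) (e y)) [interleave _ _]E odds_interleave.
- apply: measurable_fun_cantor => n; rewrite /pair_code /interleave.
  case: (odd n).
    apply: (@mset_pre _ _ _ _ snd (fun y => e y n./2)); first exact: measurable_snd.
    by apply: (@mset_pre _ _ _ _ e (fun z : cantorM => z n./2)) => //; exact: measurable_coord.
  apply: (@mset_pre _ _ _ _ fst (fun y => c y n./2)); first exact: measurable_fst.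
  by apply: (@mset_pre _ _ _ _ c (fun z : cantorM => z n./2)) => //; exact: measurable_coord.
- rewrite (_ : range _ = [set z : cantorM | range c (evens z) /\ range e (odds z)]).
    apply: msetA; first exact: (mset_pre (A := range c) measurable_evens).
    exact: (mset_pre (A := range e) measurable_odds).
  apply/seteqP; split=> [_ [[x y] _ <-]|z [[x _ cx] [y _ ey]]] /=.
    by rewrite /pair_code /= evens_interleave odds_interleave; split; [exists x|exists y].
  by exists (x, y) => //; rewrite /pair_code/= cx ey interleave_evens_odds.
- suff : measurable `<=` [set A : set (X * Y) | exists2 B, measurable B & A = pair_code c e @^-1` B] by [].
  apply: smallest_sub; first exact: sigma_algebra_code.
  move=> A [[B mB <-]|[B mB <-]].
    have [B' mB' ->] := sc _ mB; exists [set z : cantorM | B' (evens z)].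
      exact: (mset_pre (A := B') measurable_evens).
    by apply/seteqP; split => -[x y]; rewrite /pair_code /= evens_interleave; [case|].
  have [B' mB' ->] := se _ mB; exists [set z : cantorM | B' (odds z)].
    exact: (mset_pre (A := B') measurable_odds).
  by apply/seteqP; split => -[x y]; rewrite /pair_code /= odds_interleave; [case|].
Qed.

(** The Dedekind cut of [r], as the indicator of the rationals above [r]; bits whose index codes no
    rational are false. *)
Definition real_code (R : realType) (r : R) : cantorM :=
  fun n => if pickle_inv n is Some q then r < ratr q else false.

Lemma real_codeE (R : realType) (r : R) (q : rat) :
  real_code r (pickle q) = (r < ratr q).
Proof. by rewrite /real_code pickleK_inv. Qed.

(** A countable description of the range of [real_code], from which that range is seen to be Borel:
    proper nonempty upper sets of rationals without least element. *)
Definition is_cut (z : cantorM) := [/\ 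
  forall n, pickle_inv n = None :> option rat -> ~ z n,
  exists q : rat, z (pickle q), exists q : rat, ~ z (pickle q) &
  forall q : rat, z (pickle q) <-> exists q', q' < q /\ z (pickle q')].

Lemma real_code_cut (R : realType) (z : cantorM) :
  is_cut z -> exists r : R, real_code r = z.
Proof.
move=> [z0 [q1 zq1] [q0 zq0] zq].
have zle (q q' : rat) : q <= q' -> z (pickle q) -> z (pickle q').
  rewrite le_eqVlt => /predU1P[->//|qq'] h; apply/zq; exists q; split=> //.
pose S : set R := [set ratr q | q in [set q | z (pickle q)]].
have S0 : S !=set0 by exists (ratr q1), q1.
have lS : has_lbound S.
  exists (ratr q0) => _ [q zqq <-]; rewrite ler_rat leNgt; apply/negP => /ltW lt.
  exact/zq0/(zle q).
exists (inf S); apply/funext => n; rewrite /real_code.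
case E : (pickle_inv n) => [q|]; last by apply/esym/negbTE/negP; exact: z0.
have -> : n = pickle q by have := @pickle_invK rat n; rewrite E.
apply/idP/idP => [|zz].
  move=> /inf_lt -/(_ S0)[_ [q' zq' <-]]; rewrite ltr_rat => lt.
  by apply: (zle q') => //; exact: ltW.
have [q' [q'q zq']] := (zq q).1 zz.
apply: (@le_lt_trans _ _ (ratr q')); last by rewrite ltr_rat.
by apply: ge_inf => //; exists q'.
Qed.

Lemma coded_real (R : realType) : coded (@real_code R).
Proof.
have mcode n : measurable [set r : R | real_code r n].
  rewrite /real_code; case: (pickle_inv n) => [q|]; last exact: mset_cst.
  rewrite (_ : mkset _ = `]-oo, (ratr q : R)[%classic); first exact: measurable_itv.
  by apply/seteqP; split=> r /=; rewrite in_itv.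
split.
- move=> r s E; apply/eqP; rewrite eq_le; apply/andP; split.
    rewrite leNgt; apply/negP => /rat_in_itvoo[q]; rewrite in_itv/= => /andP[sq qr].
    by have := real_codeE s q; rewrite -E real_codeE sq ltNge (ltW qr).
  rewrite leNgt; apply/negP => /rat_in_itvoo[q]; rewrite in_itv/= => /andP[sq qr].
  by have := real_codeE r q; rewrite E real_codeE sq ltNge (ltW qr).
- exact: measurable_fun_cantor.
- rewrite (_ : range _ = [set z | is_cut z]); last first.
    apply/seteqP; split=> [_ [r _ <-]|z /(real_code_cut R)[r <-]]; last by exists r.
    split.
    + by move=> n; rewrite /real_code => ->.
    + have /rat_in_itvoo[q] : r < r + 1 by rewrite ltrDl.
      by rewrite in_itv/= => /andP[rq _]; exists q; rewrite real_codeE.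
    + have /rat_in_itvoo[q] : r - 1 < r by rewrite ltrBlDr ltrDl.
      rewrite in_itv/= => /andP[_ qr]; exists q; rewrite real_codeE.
      by apply/negP; rewrite -leNgt ltW.
    + move=> q; rewrite real_codeE; split=> [/rat_in_itvoo[q']|[q' [q'q]]].
        rewrite in_itv/= => /andP[rq']; rewrite ltr_rat => q'q.
        by exists q'; rewrite real_codeE.
      by rewrite real_codeE => /lt_trans; apply; rewrite ltr_rat.
  rewrite (_ : mkset _ = [set z : cantorM | ((forall n, pickle_inv n = None :> option rat -> ~ z n) /\
     (exists q : rat, z (pickle q))) /\ ((exists q : rat, ~ z (pickle q)) /\
     (forall q : rat, (z (pickle q) -> (exists q', q' < q /\ z (pickle q'))) /\
     ((exists q', q' < q /\ z (pickle q')) -> z (pickle q))))]); last first.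
    apply/seteqP; split=> z /=; first by case.
    by case=> -[? ?] [? h]; split=> // q; case: (h q).
  have mq (q : rat) : measurable [set z : cantorM | exists q' : rat, q' < q /\ z (pickle q')].
    apply: mset_ex => q'; apply: msetA; first exact: mset_cst.
    exact: measurable_coord.
  apply: msetA; apply: msetA.
  + apply: mset_all => n; apply: msetI; first exact: mset_cst.
    by apply: msetN; exact: measurable_coord.
  + by apply: mset_ex => q; exact: measurable_coord.
  + by apply: mset_ex => q; apply: msetN; exact: measurable_coord.
  + apply: mset_all => q; apply: msetA; apply: msetI => //; exact: measurable_coord.
- have mE : @measurable _ R = <<s @RGenInftyO.G R >>.
    exact: RGenInftyO.measurableE.
  move=> A mA; have : <<s @RGenInftyO.G R >> A by rewrite -mE.
  move: A {mA}; apply: smallest_sub; first exact: sigma_algebra_code.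
  move=> _ [x ->]; exists [set z : cantorM | exists q : rat, ratr q <= x /\ z (pickle q)].
    by apply: mset_ex => q; apply: msetA; [exact: mset_cst|exact: measurable_coord].
  apply/seteqP; split=> r /=; rewrite in_itv /=.
    move=> /rat_in_itvoo[q]; rewrite in_itv/= => /andP[rq qx].
    by exists q; rewrite real_codeE; split=> //; exact: ltW.
  by move=> [q [qx]]; rewrite real_codeE => /lt_le_trans; apply.
Qed.

Lemma standard_borel_coded (d : measure_display) (J : measurableType d) (R : realType) :
  standard_borel J R -> exists c : J -> cantorM, coded c.
Proof.
move=> [f [injf [mf [rf imf]]]]; exists (@real_code R \o f).
have [ic mc rc sc] := coded_real R; split.
- exact: inj_comp.
- exact: measurableT_comp.
- have [B mB rfE] := sc _ rf.
  rewrite (_ : range _ = range (@real_code R) `&` B); first exact: measurableI.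
  apply/seteqP; split=> [_ [x _ <-]|_ [[r _ <-] Br]].
    split; first by exists (f x).
    have : range f (f x) by exists x.
    by rewrite rfE.
  have : range f r by rewrite rfE.
  by case=> x _ <-; exists x.
- move=> A /imf/sc[B mB fA]; exists B => //.
  rewrite comp_preimage -fA; apply/seteqP; split=> x; first by exists x.
  by case=> y Ay /injf <-.
Qed.

(** * Borel sets with finite sections *)

(* Lusin-Souslin: the preimages of the two halves of each coordinate of the code
   have disjoint analytic projections, and separating them decodes the only
   point of a section. *)
Lemma uniformization (d d' : measure_display) (X : measurableType d)
    (Y : measurableType d') (c : X -> cantorM) (e : Y -> cantorM) (E : set (X * Y)) :
  coded c -> coded e -> measurable E ->
  (forall x y y', E (x, y) -> E (x, y') -> y = y') ->
  exists2 h : X -> Y, measurable_fun setT h & forall x y, E (x, y) -> h x = y.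
Proof.
move=> cc ce mE uE; have [ic mc rc _] := cc; have [ie me re se] := ce.
have [_ _ _ /(_ _ mE)[B mB EB]] := coded_prod cc ce.
pose Z n b := [set z : cantorM | [/\ B z, range c (evens z), range e (odds z) & odds z n = b]].
have mZ n b : measurable (Z n b).
  rewrite (_ : Z n b = [set z : cantorM | (B z /\ range c (evens z)) /\ (range e (odds z) /\
      (if b then odds z n : Prop else ~ odds z n))]).
    apply: msetA; apply: msetA => //.
    - exact: (mset_pre (A := range c) measurable_evens).
    - exact: (mset_pre (A := range e) measurable_odds).
    - by case: b; [|apply: msetN]; exact: measurable_coord.
  apply/seteqP; split=> z /=; first by case=> ? ? ? <-; case: (odds z n).
  case=> -[? ?] [? zb]; split=> //; case: b zb => //.
  by move/negP/negbTE.
pose P n b := [set x : cantorM | exists y, Z n b (interleave x y)].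
have aP n b : analytic (P n b).
  by apply: analytic_proj; exact/measurable_analytic.
have sepP n : borel_separated (P n true) (P n false).
  apply: analytic_separated => //; apply/seteqP; split=> // z [].
  move=> [y [By + + yn]] [y' [By' _ + yn']].
  rewrite !evens_interleave !odds_interleave => -[x _ cx] [w _ ew] [w' _ ew'].
  have ww' : w = w' by apply: (uE x); rewrite EB /preimage /= /pair_code /= ?ew ?ew' cx.
  by move: yn yn'; rewrite !odds_interleave -ew -ew' ww' => ->.
pose M n := projT1 (cid (sepP n)).
have MP n : [/\ measurable (M n), P n true `<=` M n & P n false `<=` ~` M n].
  exact: (projT2 (cid (sepP n))).
pose g x : cantorM := fun n => `[< M n (c x) >].
have mg : measurable_fun setT g.
  apply: measurable_fun_cantor => n.
  rewrite (_ : mkset _ = [set x | M n (c x)]).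
    by apply: (mset_pre (A := M n) mc); case: (MP n).
  by apply/seteqP; split=> x /asboolP.
have gE x y : E (x, y) -> g x = e y.
  move=> Exy; apply/funext => n; rewrite /g.
  have Pn : P n (e y n) (c x).
    exists (e y); split; rewrite ?evens_interleave ?odds_interleave//.
    by move: Exy; rewrite EB.
  case: (MP n) => _ M1 M0; move: Pn; case: (e y n) => [/M1|/M0] h.
    exact: asboolT.
  exact: asboolF.
(* Where the decoded digits are not the code of any point, [h] is the constant [point]. The two
   cases are told apart by the Borel set [range e], which gives measurability. *)
pose h x := xget point [set y | e y = g x].
have hE x : e (h x) = g x \/ ~ range e (g x) /\ h x = point.
  by rewrite /h; case: xgetP => [y -> /= ->|nh]; [left|right; split=> //; case=> y _ ey; exact: (nh y)].
exists h.
  apply: mset_mfun => A /se[B' mB' ->].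
  rewrite (_ : mkset _ = [set x | (range e (g x) /\ B' (g x)) \/ 
                                  (~ range e (g x) /\ B' (e point))]).
    apply: msetO; apply: msetA.
    - exact: (mset_pre (A := range e) mg).
    - exact: (mset_pre (A := B') mg).
    - by apply: msetN; exact: (mset_pre (A := range e) mg).
    - exact: mset_cst.
  apply/seteqP; split=> x /=; case: (hE x).
  - by move=> eg; rewrite -eg => ?; left; split=> //; exact: imageT.
  - by move=> [ng ->] ?; right.
  - by move=> eg [[_ Bg]|[nr _]]; [rewrite eg|case: nr; rewrite -eg; exact: imageT].
  - by move=> [ng ->] [[]|[]].
by move=> x y /gE gx; rewrite /h; case: xgetP => [y' -> /= ey'|/(_ y) nh]; [apply: ie; rewrite ey'|case: nh].
Qed.

Definition le_card (T : eqType) (D : nat) (A : set T) :=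
  forall s : seq T, uniq s -> (forall y, y \in s -> A y) -> (size s <= D)%N.

Lemma le_card_remove (T : eqType) (D : nat) (A B : set T) (a : T) :
  le_card D.+1 A -> A a -> B `<=` A -> ~ B a -> le_card D B.
Proof.
move=> cA Aa BA nBa s us sB; rewrite -ltnS.
apply: (cA (a :: s)) => /=.
  by rewrite us andbT; apply/negP => /sB.
by move=> y; rewrite inE => /predU1P[->//|/sB/BA].
Qed.

(** Induction on the bound, over all base spaces [X] at once. [E2 n b] collects the points of a
    section having digit [b] at [n] while another point of the section has the opposite digit; its
    sections miss that other point, so they are smaller. What no [E2 n b] contains has sections with
    at most one point. *)
Lemma bounded_uniformization (D : nat) (d d' : measure_display) (X : measurableType d)
    (Y : measurableType d') (c : X -> cantorM) (e : Y -> cantorM) (E : set (X * Y)) :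
  coded c -> coded e -> measurable E ->
  (forall x, le_card D [set y | E (x, y)]) ->
  exists2 h : nat -> X -> Y, forall i, measurable_fun setT (h i) &
    forall x y, E (x, y) -> exists i, h i x = y.
Proof.
elim: D d X c E => [|D IH] d X c E cc ce mE cE.
  exists (fun _ _ => point); first by move=> i; exact: measurable_cst.
  move=> x y Exy; have /= := cE x [:: y] erefl.
  by move=> h; suff : false by []; apply: h => z; rewrite inE => /eqP ->.
have [ie me re se] := ce.
pose nb n (z : Y) b := e z n == b.
have mnb n b : measurable [set z | nb n z b].
  rewrite (_ : mkset _ = [set z | if b then e z n : Prop else ~ e z n]).
    have m1 := mset_pre (A := fun z : cantorM => z n) me (@measurable_coord n).
    by case: b; [exact: m1|exact: msetN].
  apply/seteqP; split=> z; rewrite /nb /=; case: b; case: (e z n) => //.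
(* a point of a section is singled out by the digits that another point of the
   section does not share *)
pose Ed n b := [set p : X * Y | E p /\ nb n p.2 b].
pose E2 n b := [set p : X * Y | Ed n b p /\ exists y', Ed n (~~ b) (p.1, y')].
have mEd n b : measurable (Ed n b).
  apply: msetA => //.
  exact: (mset_pre (A := fun z => nb n z b) measurable_snd (mnb n b)).
have mE2 n b : measurable (E2 n b).
  (* Measurability of [E2] also comes from the induction hypothesis, now over the base [X * Y]: the
     section of [K] at [p] omits the point [p.2], so it has at most [D] elements. *)
  pose K := [set p : (X * Y) * Y | Ed n b p.1 /\ Ed n (~~ b) (p.1.1, p.2)].
  have mK : measurable K.
    apply: msetA; first exact: (mset_pre (A := Ed n b) measurable_fst (mEd n b)).
    apply: (mset_pre (A := Ed n (~~ b)) (f := fun p : (X * Y) * Y => (p.1.1, p.2))); last exact: mEd.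
    apply: measurable_fun_pair; last exact: measurable_snd.
    by apply: measurableT_comp; [exact: measurable_fst|exact: measurable_fst].
  have cK p : le_card D [set y | K (p, y)].
    have [Ep|nEp] := pselect (Ed n b p); last first.
      by move=> [//|y s] _ /(_ y); rewrite inE eqxx => /(_ isT)[/nEp].
    apply: (le_card_remove (cE p.1) (a := p.2)).
    - by case: Ep => Ep _; rewrite /= -surjective_pairing.
    - by move=> y [_ []].
    - move=> [_ [_]]; case: Ep => _; rewrite /nb /= => /eqP ->.
      by case: (b).
  have [h mh hK] := IH _ _ _ K (coded_prod cc ce) ce mK cK.
  rewrite (_ : E2 n b = [set p | Ed n b p /\ exists i, Ed n (~~ b) (p.1, h i p)]).
    apply: msetA; first exact: mEd.
    apply: mset_ex => i.
    apply: (mset_pre (A := Ed n (~~ b)) (f := fun p : X * Y => (p.1, h i p))); last exact: mEd.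
    by apply: measurable_fun_pair => //; exact: measurable_fst.
  apply/seteqP; split=> p [Ep].
    by move=> [y' Ey']; split=> //; have [i hi] := hK p y' (conj Ep Ey'); exists i; rewrite hi.
  by move=> [i hi]; split=> //; exists (h i p).
pose E1 := [set p | E p /\ ~ exists nb : nat * bool, E2 nb.1 nb.2 p].
have mE1 : measurable E1.
  by apply: msetA => //; apply: msetN; apply: mset_ex => -[n b]; exact: mE2.
have uE1 x y y' : E1 (x, y) -> E1 (x, y') -> y = y'.
  move=> [Ey nEy] [Ey' _]; apply: contrapT => yy'; apply: nEy.
  have [n en] : exists n, e y n <> e y' n.
    apply: contrapT => /forallNP h; apply: yy'; apply: ie; apply/funext => n.
    exact: contrapT (h n).
  exists (n, e y n); split; first by split=> //; exact: eqxx.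
  by exists y'; split=> //; rewrite /nb /=; case: (e y n) en; case: (e y' n).
have [h1 mh1 h1E] := uniformization cc ce mE1 uE1.
have /choice[h2 h2P] (nb' : nat * bool) : exists h : nat -> X -> Y,
    (forall i, measurable_fun setT (h i)) /\
    forall x y, E2 nb'.1 nb'.2 (x, y) -> exists i, h i x = y.
  case: nb' => n b.
  have [x|h mh hE] := IH _ _ _ (E2 n b) cc ce (mE2 n b); last by exists h.
  have [[y' Ey']|ny'] := pselect (exists y', Ed n (~~ b) (x, y')).
    apply: (le_card_remove (cE x) (a := y')); first by case: Ey'.
      by move=> y [[]].
    case: Ey' => /= _ h [[_]]; move: h; rewrite /nb /= => /eqP ->; by case: (b).
  by move=> [//|y s] _ /(_ y); rewrite inE eqxx => /(_ isT)[_ /ny'].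
exists (fun k => if k isn't k'.+1 then h1 else
    if unpickle k' is Some (nb', i) then h2 nb' i else h1).
  by move=> [//|k]; case: unpickle => [[nb' i]|//]; exact: (h2P nb').1.
move=> x y Exy; have [[nb' E2xy]|nE2] := pselect (exists nb : nat * bool, E2 nb.1 nb.2 (x, y)).
  have [i <-] := (h2P nb').2 _ _ E2xy.
  by exists (pickle (nb', i)).+1; rewrite pickleK.
by exists 0%N; exact: h1E.
Qed.

Lemma measurable_diag (d : measure_display) (X : measurableType d) (c : X -> cantorM) :
  coded c -> measurable [set p : X * X | p.1 = p.2].
Proof.
move=> [ic mc _ _].
have m1 n := mset_pre (A := fun z : cantorM => z n)
  (measurableT_comp mc measurable_fst) (@measurable_coord n).
have m2 n := mset_pre (A := fun z : cantorM => z n)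
  (measurableT_comp mc measurable_snd) (@measurable_coord n).
rewrite (_ : mkset _ = [set p : X * X | forall n, (c p.1 n -> c p.2 n) /\ (c p.2 n -> c p.1 n)]).
  apply: mset_all => n; apply: msetA; apply: msetI; [exact: m1|exact: m2|exact: m2|exact: m1].
apply/seteqP; split=> -[x y] /=; first by move=> ->.
by move=> h; apply: ic; apply/funext => n; apply/idP/idP; case: (h n).
Qed.

Lemma counting_le_card (T : choiceType) (R : realType) (A : set T) (D : nat) :
  (counting A <= (D%:R)%:E :> \bar R)%E -> finite_set A /\ le_card D A.
Proof.
rewrite /counting; case: asboolP => // fA; rewrite lee_fin ler_nat => cA.
split=> // s us sA; apply: leq_trans cA.
rewrite -(undup_id us) -card_fseq; apply: fsubset_leq_card.
by apply/fsubsetP => y; rewrite inE /= => /sA Ay; rewrite in_fset_set// inE.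
Qed.

Lemma counting_set1 (T : choiceType) (R : realType) (x : T) :
  counting [set x] = 1%E :> \bar R.
Proof. by rewrite /counting asboolT// fset_set1 cardfs1. Qed.

(** * Measure-preserving partial isomorphisms *)

(** The maps are total and only their behaviour on [pdom] and [pcod] matters. The image of [A] is
    written as a preimage under [pbw], which makes it visibly measurable. *)
Record piso (d : measure_display) (J : measurableType d) (R : realType)
    (mu : probability J R) := Piso {
  pdom : set J; pcod : set J; pfw : J -> J; pbw : J -> J;
  measurable_pdom : measurable pdom; measurable_pcod : measurable pcod;
  measurable_pfw : measurable_fun setT pfw; measurable_pbw : measurable_fun setT pbw;
  pfwP : forall x, pdom x -> pcod (pfw x) /\ pbw (pfw x) = x;
  pbwP : forall y, pcod y -> pdom (pbw y) /\ pfw (pbw y) = y;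
  piso_mu : forall A, measurable A -> A `<=` pdom ->
    mu A = mu [set y | pcod y /\ A (pbw y)] }.

Section piso.
Context (d : measure_display) (J : measurableType d) (R : realType)
  (mu : probability J R).
Implicit Types p q : piso mu.

Definition prel p (x y : J) := pdom p x /\ pfw p x = y.

Lemma prelE p x y : prel p x y <-> pcod p y /\ pbw p y = x.
Proof.
split=> [[/pfwP[cx bx] <-]|[/pbwP[cx bx] <-]]; by split.
Qed.

Lemma pid_subproof (A : set J) : measurable A -> A `<=` setT ->
  mu A = mu [set y | [set: J] y /\ A y].
Proof. by move=> _ _; congr (mu _); apply/seteqP; split=> x // []. Qed.

Definition pid : piso mu := @Piso _ _ _ mu setT setT id id measurableT measurableT
  (@measurable_id _ _ _) (@measurable_id _ _ _)
  (fun x _ => conj I erefl) (fun x _ => conj I erefl) pid_subproof.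

Lemma pcomp_subproof p q : exists r, forall x y,
  prel r x y <-> exists z, prel p x z /\ prel q z y.
Proof.
have md : measurable [set x | pdom p x /\ pdom q (pfw p x)].
  apply: msetA; first exact: measurable_pdom.
  exact: (mset_pre (A := pdom q) (@measurable_pfw _ _ _ _ p) (@measurable_pdom _ _ _ _ q)).
have mc : measurable [set y | pcod q y /\ pcod p (pbw q y)].
  apply: msetA; first exact: measurable_pcod.
  exact: (mset_pre (A := pcod p) (@measurable_pbw _ _ _ _ q) (@measurable_pcod _ _ _ _ p)).
have mf : measurable_fun setT (pfw q \o pfw p).
  by apply: measurableT_comp; exact: measurable_pfw.
have mb : measurable_fun setT (pbw p \o pbw q).
  by apply: measurableT_comp; exact: measurable_pbw.
unshelve eexists (@Piso _ _ _ mu _ _ _ _ md mc mf mb _ _ _).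
- move=> x [px qx] /=; have [? ->] := pfwP qx; have [? ->] := pfwP px.
  by split.
- move=> y [qy py] /=; have [? ->] := pbwP py; have [? ->] := pbwP qy.
  by split.
- move=> A mA AD.
  have mA' : measurable [set y | pcod p y /\ A (pbw p y)].
    apply: msetA; first exact: measurable_pcod.
    exact: (mset_pre (A := A) (@measurable_pbw _ _ _ _ p)).
  rewrite (@piso_mu _ _ _ _ p)//; last by move=> x /AD[].
  rewrite (@piso_mu _ _ _ _ q)//; last first.
    by move=> y [py /AD[_]]; have [_ ->] := pbwP py.
  by congr (mu _); apply/seteqP; split=> y /=; [move=> [? []]|move=> [[]]].
- move=> x y; rewrite /prel /=; split.
    by move=> [[px qx] <-]; exists (pfw p x).
  by move=> [z [[px <-] [qx <-]]].
Qed.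

Definition pcomp p q := projT1 (cid (pcomp_subproof p q)).

Lemma pcompP p q x y : prel (pcomp p q) x y <-> exists z, prel p x z /\ prel q z y.
Proof. exact: (projT2 (cid (pcomp_subproof p q))). Qed.

End piso.

Definition cyl (X : Type) (c : X -> cantorM) (s : seq bool) : set X :=
  [set x | mkseq (c x) (size s) = s].

Lemma measurable_cyl (d : measure_display) (X : measurableType d) (c : X -> cantorM) s :
  measurable_fun setT c -> measurable (cyl c s).
Proof.
move=> mc; rewrite (_ : cyl c s = [set x | forall i, (i < size s)%N ->
    if nth false s i then c x i : Prop else ~ c x i]).
  apply: mset_all => i; apply: msetI; first exact: mset_cst.
  have m1 := mset_pre (A := fun z : cantorM => z i) mc (@measurable_coord i).
  by case: nth => //; exact: msetN.
apply/seteqP; split=> x; rewrite /cyl /=.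
  by move=> {2}<- i il; rewrite nth_mkseq//; case: (c x i).
move=> h; apply: (@eq_from_nth _ false); rewrite size_mkseq// => i il.
by rewrite nth_mkseq//; have := h i il; case: nth => [->//|/negP/negbTE ->].
Qed.

Lemma cyl_separates (X : eqType) (c : X -> cantorM) (K : seq X) (v : X) :
  injective c -> v \notin K ->
  exists s, cyl c s v /\ forall y, y \in K -> ~ cyl c s y.
Proof.
move=> ic; elim: K => [|a K IH]; first by exists [::].
rewrite inE negb_or => /andP[va /IH[s [sv sK]]].
have [n nE] : exists n, c v n <> c a n.
  apply: contrapT => /forallNP h; move/eqP: va; apply; apply: ic.
  by apply/funext => n; exact: contrapT (h n).
exists (mkseq (c v) (maxn (size s) n.+1)); split.
  by rewrite /cyl /= size_mkseq.
move=> y; rewrite inE /cyl /= size_mkseq => /predU1P[->|yK] E.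
  have := congr1 (fun t => nth false t n) E.
  by rewrite !nth_mkseq ?leq_maxr// => h; apply: nE.
apply: (sK _ yK); rewrite /cyl /= -[RHS]sv.
apply: (@eq_from_nth _ false); rewrite !size_mkseq// => i il.
have := congr1 (fun t => nth false t i) E.
have il' : (i < maxn (size s) n.+1)%N by rewrite leq_max il.
by rewrite !nth_mkseq.
Qed.

(* Each edge (x, y) is isolated by two cylinders: y is the only neighbour of x in
   the one and x the only neighbour of y in the other, so that on such pieces the
   mass exchange identity of a graphing compares mu A with mu of its image. *)
Lemma graphing_pisos (d : measure_display) (J : measurableType d) (R : realType)
    (mu : probability J R) (E : set (J * J)) : graphing mu E ->
  exists theta : nat -> piso mu,
    forall x y, component E x y <-> exists n, prel (theta n) x y.
Proof.
move=> [/standard_borel_coded[c cc] [mE sE _] [D hD] mtp].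
have [ic mc _ _] := cc.
have finE x : finite_set (nbhd E x).
  by have := hD x; rewrite /deg setTI => /counting_le_card[].
have cardE x : le_card D (nbhd E x).
  by have := hD x; rewrite /deg setTI => /counting_le_card[].
have [h mh hE] := bounded_uniformization cc cc mE cardE.
have mdiag := measurable_diag cc.
(* The conditions are symmetric: exchanging [i] with [j] and [s] with [t] yields the codomain, on
   which [h j] inverts [h i]. *)
pose dm i j s t := [set x | ((E (x, h i x) /\ h j (h i x) = x) /\
  (cyl c t x /\ cyl c s (h i x))) /\
  ((forall k, E (x, h k x) -> cyl c s (h k x) -> h k x = h i x) /\
   (forall k, E (h i x, h k (h i x)) -> cyl c t (h k (h i x)) -> h k (h i x) = x))].
have mdm i j s t : measurable (dm i j s t).
  have mp (f g : J -> J) (A : set (J * J)) : measurable_fun setT f ->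
      measurable_fun setT g -> measurable A -> measurable [set x | A (f x, g x)].
    move=> mf mg mA; apply: (mset_pre (A := A) (f := fun x => (f x, g x))) => //.
    exact: measurable_fun_pair.
  have mhh k l : measurable_fun setT (fun x => h k (h l x)).
    exact: measurableT_comp.
  have mcyl (f : J -> J) r : measurable_fun setT f -> measurable [set x | cyl c r (f x)].
    by move=> mf; apply: (mset_pre (A := cyl c r) mf); exact: measurable_cyl.
  have meq (f g : J -> J) : measurable_fun setT f -> measurable_fun setT g ->
      measurable [set x | f x = g x].
    by move=> mf mg; exact: (mp f g [set p | p.1 = p.2]).
  have mi : measurable_fun setT (@id J) by exact: measurable_id.
  apply: msetA; apply: msetA.
  - by apply: msetA; [exact: (mp id (h i))|exact: (meq _ id)].
  - by apply: msetA; [exact: (mcyl id)|exact: mcyl].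
  - apply: mset_all => k; apply: msetI; first exact: (mp id (h k)).
    by apply: msetI; [exact: mcyl|exact: meq].
  - apply: mset_all => k; apply: msetI; first exact: (mp (h i)).
    by apply: msetI; [exact: mcyl|exact: (meq _ id)].
have dmP i j s t x : dm i j s t x -> dm j i t s (h i x) /\ h j (h i x) = x.
  move=> [[[Ex hx] [tx sx]] [u1 u2]]; split=> //; rewrite /dm /= hx.
  by do !split=> //; exact: sE.
have deg1 i j s t (Q : set J) x : dm i j s t x -> Q (h i x) -> Q `<=` cyl c s ->
    deg R E Q x = 1%E.
  move=> [[[Ex hx] [tx sx]] [u1 u2]] Qx Qs.
  rewrite /deg (_ : _ `&` _ = [set h i x]); first exact: counting_set1.
  apply/seteqP; split=> [y [Qy Ey]|_ ->] //=.
  have [k hk] := hE _ _ Ey; rewrite -hk; apply: u1; rewrite hk//.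
  exact: Qs.
have dmu i j s t A : measurable A -> A `<=` dm i j s t ->
    mu A = mu [set y | dm j i t s y /\ A (h j y)].
  move=> mA Adm; set Q := [set y | _].
  have mQ : measurable Q.
    by apply: msetA; [exact: mdm|exact: (mset_pre (A := A) (mh j))].
  have := mtp A Q mA mQ.
  rewrite (eq_integral (cst 1%E)); last first.
    move=> x; rewrite inE => Ax; have [dy hx] := dmP _ _ _ _ _ (Adm _ Ax).
    apply: deg1 (Adm _ Ax) _ _ => [|y [[[_ [? _]] _] _]] //.
    by split=> //; rewrite hx.
  rewrite [RHS](eq_integral (cst 1%E)); last first.
    move=> y; rewrite inE => -[dy Ay]; apply: (deg1 j i t s) => // x /Adm.
    by case=> -[_ []].
  by rewrite !integral_cst// !mul1e.
pose base (a : nat * nat * (seq bool * seq bool)) : piso mu :=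
  let: (i, j, (s, t)) := a in
  @Piso _ _ _ mu (dm i j s t) (dm j i t s) (h i) (h j) (mdm _ _ _ _) (mdm _ _ _ _)
    (mh i) (mh j) (dmP i j s t) (dmP j i t s) (dmu i j s t).
have baseE a x y : prel (base a) x y -> E (x, y).
  by case: a => -[i j] [s t] [[[[Ex _] _] _] <-].
have Ebase x y : E (x, y) -> exists a, prel (base a) x y.
  move=> Exy; have [i hi] := hE _ _ Exy; have [j hj] := hE _ _ (sE _ _ Exy).
  have sep u v : E (u, v) -> exists s, cyl c s v /\
      forall w, E (u, w) -> cyl c s w -> w = v.
    move=> Euv; have /finite_seqP[K KE] := finE u.
    have : v \notin rem v (undup K) by rewrite mem_rem_uniqF// undup_uniq.
    move=> /(cyl_separates ic)[s [sv sK]]; exists s; split=> // w Euw sw.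
    apply: contrapT => /eqP wv; apply: (sK w) => //.
    rewrite mem_rem_uniq ?undup_uniq// !inE wv mem_undup.
    by have : nbhd E u w by []; rewrite KE.
  have [s [sy us]] := sep _ _ Exy; have [t [tx ut]] := sep _ _ (sE _ _ Exy).
  exists (i, j, (s, t)); split=> //=; rewrite /dm /= hi hj.
  by do !split=> //; move=> k Ek ck; [exact: us|exact: ut].
(* Single edges are covered by the maps [base a], paths by their finite compositions. Words are
   enumerated by [unpickle]; the default, the empty word, is the identity and joins each point to
   itself. *)
pose word := foldr (fun a p => pcomp (base a) p) (pid mu).
exists (fun n => word (odflt [::] (unpickle n))) => x y; split.
  move=> /clos_rt_rt1n_iff; elim=> [z|u v w Euv _ [n nP]].
    by exists (pickle ([::] : seq (nat * nat * (seq bool * seq bool)))); rewrite pickleK.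
  have [a aP] := Ebase _ _ Euv.
  exists (pickle (a :: odflt [::] (unpickle n))); rewrite pickleK /=.
  by apply/pcompP; exists v.
move=> [n]; elim: (odflt _ _) x => [x [_ <-]|a w IH x]; first exact: rt_refl.
move=> /pcompP[z [/baseE Exz /IH czy]].
by apply: (rt_trans _ _ _ z) => //; exact: rt_step.
Qed.

(** * Counting along the components of a graphing *)

(** The choices made for [E] are bundled as data, because the measure [emeas] below is defined from
    them. *)
Record gdata (d : measure_display) (J : measurableType d) (R : realType)
    (mu : probability J R) (E : set (J * J)) := GData {
  gcode : J -> cantorM;
  gcodeP : coded gcode;
  gpiso : nat -> piso mu;
  gpisoP : forall x y, component E x y <-> exists n, prel (gpiso n) x y;
  gdataP : graphing mu E }.

Lemma graphing_gdata (d : measure_display) (J : measurableType d) (R : realType)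
    (mu : probability J R) (E : set (J * J)) :
  graphing mu E -> inhabited (gdata mu E).
Proof.
move=> gE; have [theta thetaP] := graphing_pisos gE.
have [/standard_borel_coded[c cc] _ _ _] := gE.
exact: inhabits (GData cc thetaP gE).
Qed.

Definition crel (T : Type) (F : set (T * T)) : set (T * T) :=
  [set p | component F p.1 p.2].

Definition transpose (T : Type) (K : set (T * T)) : set (T * T) :=
  [set p | K (p.2, p.1)].

Lemma component_refl (T : Type) (F : set (T * T)) x : component F x x.
Proof. exact: rt_refl. Qed.

Lemma component_step (T : Type) (F : set (T * T)) x y : F (x, y) -> component F x y.
Proof. exact: rt_step. Qed.

Lemma component_trans (T : Type) (F : set (T * T)) x y z :
  component F x y -> component F y z -> component F x z.
Proof. exact: rt_trans. Qed.

Lemma component_sym (T : Type) (F : set (T * T)) x y : sym_edges F ->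
  component F x y -> component F y x.
Proof.
move=> sF; elim=> [u v /sF|u|u v w _ uv _ vw]; first exact: rt_step.
  exact: rt_refl.
exact: rt_trans vw uv.
Qed.

Lemma component_mono (T : Type) (F F' : set (T * T)) x :
  F `<=` F' -> component F x `<=` component F' x.
Proof.
move=> FF' y; elim=> [u v /FF'|u|u v w _ uv _ vw]; first exact: rt_step.
  exact: rt_refl.
exact: rt_trans uv vw.
Qed.

Lemma component_inv (T : Type) (F : set (T * T)) (P : T -> Prop) x y :
  P x -> (forall u v, P u -> F (u, v) -> P v) -> component F x y -> P y.
Proof.
move=> Px Pstep /clos_rt_rtn1_iff; elim=> // u v Fuv _ Pu; exact: Pstep Fuv.
Qed.

Section image_measure.
Context (d d' : measure_display) (T : measurableType d) (U : measurableType d')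
  (R : realType) (mu : {measure set T -> \bar R}) (B : set T) (f : T -> U).
Hypotheses (mB : measurable B) (mf : measurable_fun setT f).

(** The image under [f] of [mu] restricted to [B]. The measurability proofs are arguments so that
    the measure structure can be inferred from the term. *)
Definition image_meas (_ : measurable B) (_ : measurable_fun setT f) (A : set U) :=
  mu (B `&` f @^-1` A).

Local Notation im := (image_meas mB mf).

Let mpre A : measurable A -> measurable (B `&` f @^-1` A).
Proof. by move=> mA; apply: measurableI => //; rewrite -[X in measurable X]setTI; exact: mf. Qed.

Let im0 : im set0 = 0%E.
Proof. by rewrite /image_meas preimage_set0 setI0 measure0. Qed.

Let im_ge0 A : (0 <= im A)%E.
Proof. exact: measure_ge0. Qed.

Let im_additive : semi_sigma_additive im.
Proof.
move=> F mF tF mUF; rewrite /image_meas preimage_bigcup setI_bigcupr.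
apply: measure_semi_sigma_additive.
- by move=> n; exact: mpre.
- apply/trivIsetP => i j _ _ ij; apply/seteqP; split=> // x [[_ Fi] [_ Fj]].
  move/trivIsetP : tF => /(_ i j Logic.I Logic.I ij) F0.
  by suff : set0 (f x) by []; rewrite -F0.
- by rewrite -setI_bigcupr -preimage_bigcup; exact: mpre.
Qed.

HB.instance Definition _ := isMeasure.Build _ _ _ im im0 im_ge0 im_additive.
End image_measure.

Section counting.
Context (d : measure_display) (J : measurableType d) (R : realType)
  (mu : probability J R) (E : set (J * J)) (G : gdata mu E).

Local Notation theta := (gpiso G).

Lemma measurable_eq : measurable [set p : J * J | p.1 = p.2].
Proof. exact: measurable_diag (gcodeP G). Qed.

Lemma measurable_prel n : measurable [set p : J * J | prel (theta n) p.1 p.2].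
Proof.
apply: msetA.
  by apply: (mset_pre (A := pdom (theta n)) measurable_fst); exact: measurable_pdom.
apply: (mset_pre (A := fun p : J * J => p.1 = p.2)
  (f := fun p : J * J => (pfw (theta n) p.1, p.2))); last exact: measurable_eq.
apply: measurable_fun_pair; last exact: measurable_snd.
by apply: measurableT_comp; [exact: measurable_pfw|exact: measurable_fst].
Qed.

(** The range of [y] is the countable set of values [theta n (g z)], so this projection stays
    Borel. *)
Lemma mset_component_ex (d' : measure_display) (Z : measurableType d')
    (g : Z -> J) (P : Z -> J -> Prop) :
  measurable_fun setT g -> measurable [set p : Z * J | P p.1 p.2] ->
  measurable [set z | exists y, component E (g z) y /\ P z y].
Proof.
move=> mg mP; rewrite (_ : mkset _ = [set z | exists n,
    pdom (theta n) (g z) /\ P z (pfw (theta n) (g z))]).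
  apply: mset_ex => n; apply: msetA.
    by apply: (mset_pre (A := pdom (theta n)) mg); exact: measurable_pdom.
  apply: (mset_pre (A := fun p : Z * J => P p.1 p.2)
    (f := fun z => (z, pfw (theta n) (g z)))) => //.
  apply: measurable_fun_pair => //.
  by apply: measurableT_comp => //; exact: measurable_pfw.
apply/seteqP; split=> z /=.
  by move=> [y [/(gpisoP G)[n [dn <-]] Py]]; exists n.
move=> [n [dn Pn]]; exists (pfw (theta n) (g z)); split=> //.
by apply/(gpisoP G); exists n.
Qed.

Lemma mset_component_all (d' : measure_display) (Z : measurableType d')
    (g : Z -> J) (P : Z -> J -> Prop) :
  measurable_fun setT g -> measurable [set p : Z * J | P p.1 p.2] ->
  measurable [set z | forall y, component E (g z) y -> P z y].
Proof.
move=> mg mP; rewrite (_ : mkset _ =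
    [set z | ~ exists y, component E (g z) y /\ ~ P z y]).
  by apply: msetN; apply: mset_component_ex => //; exact: msetN.
apply/seteqP; split=> z /= h; first by move=> [y [/h]].
by move=> y cy; apply: contrapT => nP; apply: h; exists y.
Qed.

(** [L n] is the relation of being joined by a walk of [n] edges of [F]. Its intermediate vertex is
    sought inside the [E]-component, which keeps the quantifier countable. *)
Lemma measurable_crel F : measurable F -> F `<=` E -> measurable (crel F).
Proof.
move=> mF FE.
pose L := fix L n : set (J * J) := if n is n'.+1 then
  [set p : J * J | exists z, component E p.1 z /\ (L n' (p.1, z) /\ F (z, p.2))]
  else [set p : J * J | p.1 = p.2].
have mL n : measurable (L n).
  elim: n => [|n IH]; first exact: measurable_eq.
  apply: (@mset_component_ex _ _ fst (fun p z => L n (p.1, z) /\ F (z, p.2))).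
    exact: measurable_fst.
  have m1 : measurable_fun setT (fun q : (J * J) * J => q.1.1).
    by apply: measurableT_comp; [exact: measurable_fst|exact: measurable_fst].
  have m2 : measurable_fun setT (fun q : (J * J) * J => q.1.2).
    by apply: measurableT_comp; [exact: measurable_snd|exact: measurable_fst].
  have m3 : measurable_fun setT (fun q : (J * J) * J => q.2) by exact: measurable_snd.
  apply: msetA.
    exact: (mset_pre (A := L n) (measurable_fun_pair m1 m3)).
  exact: (mset_pre (A := F) (measurable_fun_pair m3 m2)).
rewrite (_ : crel F = [set p | exists n, L n p]).
  by apply: (@mset_ex _ _ nat (fun n p => L n p)) => n; exact: mL.
have LF n x y : L n (x, y) -> component F x y.
  elim: n y => [y /= ->|n IH y [z [_ [/IH xz Fzy]]]]; first exact: component_refl.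
  by apply: component_trans xz _; exact: component_step.
apply/seteqP; split=> -[x y]; last by move=> [n /LF].
rewrite /crel /= => /clos_rt_rtn1_iff; elim=> [|u v Fuv xu [n Ln]]; first by exists 0%N.
by exists n.+1, u; split; [exact: (component_mono FE (LF _ _ _ Ln))|split].
Qed.

Lemma sub_crel F : F `<=` E -> F `<=` crel E.
Proof. by move=> FE [x y] /FE; exact: component_step. Qed.

Lemma crel_mono F : F `<=` E -> crel F `<=` crel E.
Proof. by move=> FE [x y]; exact: component_mono. Qed.

(** The graphs of the [theta n] overlap; assigning each pair to its least index makes them a
    partition of [crel E]. *)
Definition first_piso n := [set p : J * J | prel (theta n) p.1 p.2 /\
  forall k, (k < n)%N -> ~ prel (theta k) p.1 p.2].

Lemma measurable_first n : measurable (first_piso n).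
Proof.
apply: msetA; first exact: measurable_prel.
apply: mset_all => k; apply: msetI; first exact: mset_cst.
by apply: msetN; exact: measurable_prel.
Qed.

Lemma trivIset_first : trivIset setT first_piso.
Proof.
apply/trivIsetP => i j _ _ ij; apply/seteqP; split=> // p [[pi ni] [pj nj]].
case: (ltngtP i j) => [lij|lji|eij]; first exact: nj lij pi.
  exact: ni lji pj.
by move: ij; rewrite eij eqxx.
Qed.

Lemma bigcup_first : \bigcup_n first_piso n = crel E.
Proof.
apply/seteqP; split=> [p [n _ [pn _]]|p /(gpisoP G) h].
  by apply/(gpisoP G); exists n.
have h' : exists n, `[< prel (theta n) p.1 p.2 >] by case: h => n hn; exists n; exact/asboolP.
have [n /asboolP np nmin] := ex_minnP h'; exists n => //; split=> // k kn pk.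
by have := nmin k (asboolT pk); rewrite leqNgt kn.
Qed.

Lemma deg_series (L : nat -> set (J * J)) x :
  (forall n, measurable (L n)) -> trivIset setT L ->
  (forall n y y', L n (x, y) -> L n (x, y') -> y = y') ->
  (deg R (\bigcup_n L n) setT x =
   \sum_(n <oo) (\1_[set x | exists y, L n (x, y)] x)%:E)%E.
Proof.
move=> mL tL uL; rewrite /deg setTI.
have -> : nbhd (\bigcup_n L n) x = \bigcup_n nbhd (L n) x by [].
have mN n : measurable (nbhd (L n) x).
  rewrite (_ : nbhd _ _ = xsection (L n) x); first exact: measurable_xsection.
  by apply/seteqP; split=> y; rewrite /xsection /= inE.
rewrite (measure_semi_bigcup (@counting J R))//.
- apply: eq_eseriesr => n _; rewrite indicE.
  have [[y Ly]|nL] := pselect (exists y, L n (x, y)).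
    rewrite mem_set; last by exists y.
    rewrite (_ : nbhd _ _ = [set y]); first exact: counting_set1.
    by apply/seteqP; split=> [y' /(uL _ _ _ Ly)|_ ->].
  rewrite memNset//= (_ : nbhd _ _ = set0); first exact: measure0.
  by apply/seteqP; split=> // y Ly; apply: nL; exists y.
- apply/trivIsetP => i j _ _ ij; apply/seteqP; split=> // y [Li Lj].
  by move/trivIsetP: tL => /(_ i j Logic.I Logic.I ij) L0; suff : set0 (x, y) by []; rewrite -L0.
- exact: bigcupT_measurable.
Qed.

Lemma prel_unique (p : piso mu) x y y' : prel p x y -> prel p x y' -> y = y'.
Proof. by move=> [_ <-] [_ <-]. Qed.

Lemma prel_unique_l (p : piso mu) x x' y : prel p x y -> prel p x' y -> x = x'.
Proof. by move=> /prelE[_ <-] /prelE[_ <-]. Qed.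

Definition gbase n := [set x | pdom (theta n) x /\ first_piso n (x, pfw (theta n) x)].

Definition ggraph n (x : J) := (x, pfw (theta n) x).

Lemma measurable_ggraph n : measurable_fun setT (ggraph n).
Proof. by apply: measurable_fun_pair; [exact: measurable_id|exact: measurable_pfw]. Qed.

Lemma measurable_gbase n : measurable (gbase n).
Proof.
apply: msetA; first exact: measurable_pdom.
exact: (mset_pre (A := first_piso n) (@measurable_ggraph n) (@measurable_first n)).
Qed.

(** The integral of the degree, as a series of images of [mu] along the disjoint graphs: in this
    form it is a measure by construction. It counts ordered pairs, so it is twice the edge
    measure. *)
Definition emeas : set (J * J) -> \bar R :=
  mseries (fun n => image_meas mu (@measurable_gbase n) (@measurable_ggraph n)) 0.

HB.instance Definition _ := Measure.on emeas.

Section exchange.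
Variable K : set (J * J).
Hypotheses (mK : measurable K) (KE : K `<=` crel E).

Let L n := K `&` first_piso n.

Let mL n : measurable (L n).
Proof. by apply: measurableI => //; exact: measurable_first. Qed.

Let KL : K = \bigcup_n L n.
Proof. by rewrite -setI_bigcupr bigcup_first setIidl. Qed.

Let tL : trivIset setT L.
Proof.
apply/trivIsetP => i j _ _ ij; rewrite /L setIACA.
by move/trivIsetP: trivIset_first => /(_ i j Logic.I Logic.I ij) ->; rewrite setI0.
Qed.

Let A n := [set x | exists y, L n (x, y)].

Let AE n : A n = gbase n `&` ggraph n @^-1` K.
Proof.
apply/seteqP; split=> x.
  move=> [y [Kxy [/= [dx fx] h]]]; subst y.
  by split; [split; [|split; [split|]]|].
by move=> [[dx h] Kx]; exists (pfw (theta n) x).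
Qed.

Let mA n : measurable (A n).
Proof.
rewrite AE; apply: measurableI; first exact: measurable_gbase.
exact: (mset_pre (A := K) (@measurable_ggraph n)).
Qed.

Let degA x : (deg R K setT x = \sum_(n <oo) (\1_(A n) x)%:E)%E.
Proof.
rewrite {1}KL deg_series//.
move=> n y y' [_ [p _]] [_ [p' _]].
exact: prel_unique p p'.
Qed.

Lemma measurable_deg : measurable_fun setT (deg R K setT : J -> \bar R).
Proof.
rewrite (_ : (deg R K setT : J -> \bar R) = fun x => (\sum_(n <oo) (\1_(A n) x)%:E)%E).
  apply: ge0_emeasurable_sum => // n _.
  by apply/measurable_EFinP; exact: measurable_indic.
by apply/funext.
Qed.

Lemma emeasE : (\int[mu]_x deg R K setT x = emeas K)%E.
Proof.
under eq_integral do rewrite degA.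
rewrite integral_nneseries//; last first.
  by move=> n; apply/measurable_EFinP; exact: measurable_indic.
rewrite /emeas /mseries; apply: eq_eseriesr => n _.
by rewrite integral_indic// setIT AE.
Qed.

Let B n := [set x | exists y, transpose (L n) (x, y)].

Lemma mass_transport :
  (\int[mu]_x deg R K setT x = \int[mu]_x deg R (transpose K) setT x)%E.
Proof.
(* The points with an incoming edge of the [n]-th piece form the image of [A n] under [theta n], so
   the two series agree term by term. *)
have BE n : B n = [set y | pcod (theta n) y /\ A n (pbw (theta n) y)].
  apply/seteqP; split=> y.
    move=> [x [Kx [/= p h]]]; have /prelE[cy by_] := p; split=> //.
    by exists y; rewrite by_; split.
  move=> [cy [z [Kz [/= p h]]]]; have [dy fy] := pbwP cy.
  have zy : z = y by case: p => _ <-.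
  by subst z; exists (pbw (theta n) y).
have mB n : measurable (B n).
  rewrite BE; apply: msetA; first exact: measurable_pcod.
  exact: (mset_pre (A := A n) (@measurable_pbw _ _ _ _ (theta n)) (mA n)).
have degB x : (deg R (transpose K) setT x = \sum_(n <oo) (\1_(B n) x)%:E)%E.
  rewrite {1}KL (_ : transpose _ = \bigcup_n transpose (L n))//.
  rewrite deg_series//.
  - move=> n; apply: (mset_pre (A := L n) (f := fun p : J * J => (p.2, p.1))); last exact: mL.
    by apply: measurable_fun_pair; [exact: measurable_snd|exact: measurable_fst].
  - apply/trivIsetP => i j _ _ ij; apply/seteqP; split=> // p [Li Lj].
    move/trivIsetP: tL => /(_ i j Logic.I Logic.I ij) L0.
    by suff : set0 (p.2, p.1) by []; rewrite -L0.
  - move=> n y y' [_ [p _]] [_ [p' _]]; exact: prel_unique_l p p'.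
under eq_integral do rewrite degA.
under [RHS]eq_integral do rewrite degB.
rewrite !integral_nneseries//; last 2 first.
- by move=> n; apply/measurable_EFinP; exact: measurable_indic.
- by move=> n; apply/measurable_EFinP; exact: measurable_indic.
apply: eq_eseriesr => n _; rewrite !integral_indic// !setIT BE.
by apply: piso_mu => // x [y [_ [[]]]].
Qed.

End exchange.
End counting.

Lemma component_eq (T : Type) (F : set (T * T)) x y : sym_edges F ->
  component F x y -> component F x = component F y.
Proof.
move=> sF xy; apply/seteqP; split=> z; last exact: component_trans xy.
by apply: component_trans; exact: component_sym.
Qed.

(** * Component sizes, transversals and the rank *)

Section rank.
Context (d : measure_display) (J : measurableType d) (R : realType)
  (mu : probability J R) (E : set (J * J)) (G : gdata mu E).

Definition level (F : set (J * J)) n : set J :=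
  [set x | counting (component F x) = (n%:R)%:E :> \bar R].

Lemma counting_fin (A : set J) n : counting A = (n%:R)%:E :> \bar R ->
  inv_size R A = ((n%:R)^-1)%:E.
Proof. by rewrite /counting /inv_size; case: asboolP => // fA [->]. Qed.

Lemma finite_counting (A : set J) :
  finite_set A <-> exists n, counting A = (n%:R)%:E :> \bar R.
Proof.
split=> [fA|[n]]; last by rewrite /counting; case: asboolP.
by rewrite /counting asboolT//; eexists.
Qed.

Lemma inv_size_infinite (A : set J) : ~ finite_set A -> inv_size R A = 0%E.
Proof. by move=> nA; rewrite /inv_size asboolF. Qed.

Lemma inv_size_ge0 (A : set J) : (0 <= inv_size R A)%E.
Proof. by rewrite /inv_size; case: ifP => // _; rewrite lee_fin invr_ge0. Qed.

Lemma inv_size_le1 (A : set J) : A !=set0 -> (inv_size R A <= 1)%E.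
Proof.
move=> [x Ax]; rewrite /inv_size; case: ifP => [/asboolP fA|_]; last by rewrite lee01.
rewrite lee_fin invf_le1 ?ltr0n ?ler1n cardfs_gt0; apply/fset0Pn; exists x;
  by rewrite in_fset_set// inE.
Qed.

Lemma level_uniq F m n x : level F m x -> level F n x -> m = n.
Proof. by rewrite /level /= => -> [] /eqP; rewrite eqr_nat => /eqP. Qed.

Lemma level0 F : level F 0 = set0.
Proof.
apply/seteqP; split=> // x; rewrite /level /= /counting.
case: asboolP => // fA [] /eqP; rewrite pnatr_eq0 cardfs_eq0 => /eqP f0.
have : x \in fset_set (component F x) by rewrite in_fset_set// inE; exact: component_refl.
by rewrite f0.
Qed.

Section measurability.
Variable F : set (J * J).
Hypotheses (mF : measurable F) (FE : F `<=` E).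

Lemma measurable_level n : measurable (level F n).
Proof.
have := measurable_deg G (measurable_crel G mF FE) (crel_mono FE).
move=> /(_ measurableT _ (emeasurable_set1 (n%:R)%:E)).
rewrite setTI (_ : _ @^-1` _ = level F n)//.
by apply/seteqP; split=> x; rewrite /level /= /deg setTI.
Qed.

Lemma measurable_finite_component : measurable [set x | finite_set (component F x)].
Proof.
rewrite (_ : mkset _ = [set x | exists n, level F n x]).
  by apply: mset_ex => n; exact: measurable_level.
by apply/seteqP; split=> x /= /finite_counting.
Qed.

Lemma measurable_inv_size : measurable_fun setT (fun x => inv_size R (component F x)).
Proof.
apply: mset_mfun => A mA; rewrite (_ : mkset _ = [set x |
    (exists n, level F n x /\ A ((n%:R)^-1)%:E) \/
    (~ finite_set (component F x) /\ A 0%E)]).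
  apply: msetO.
    by apply: mset_ex => n; apply: msetA; [exact: measurable_level|exact: mset_cst].
  by apply: msetA; [apply: msetN; exact: measurable_finite_component|exact: mset_cst].
apply/seteqP; split=> x /=.
  have [fx|nx] := pselect (finite_set (component F x)).
    have /finite_counting[n ln] := fx.
    by rewrite (counting_fin ln) => An; left; exists n.
  by rewrite inv_size_infinite// => A0; right.
case=> [[n [/counting_fin ->//]]|[nx]]; by rewrite inv_size_infinite.
Qed.

Lemma integral_inv_size : (\int[mu]_x inv_size R (component F x) =
  \sum_(n <oo) ((n%:R)^-1)%:E * mu (level F n))%E.
Proof.
pose D := \bigcup_n level F n.
have mD : measurable D by apply: bigcupT_measurable => n; exact: measurable_level.
transitivity (\int[mu]_(x in D) inv_size R (component F x))%E.
  rewrite [RHS]integral_mkcond; apply: eq_integral => x _; rewrite patchE.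
  case: ifPn => // /negP nD; rewrite inv_size_infinite// => /finite_counting[n ln].
  by apply: nD; rewrite inE; exists n.
rewrite ge0_integral_bigcup//.
- apply: eq_eseriesr => n _; rewrite (eq_integral (cst ((n%:R)^-1)%:E)).
    by rewrite integral_cst//; exact: measurable_level.
  by move=> x; rewrite inE => /counting_fin ->.
- by move=> n; exact: measurable_level.
- by apply: measurable_funTS; exact: measurable_inv_size.
- by move=> x _; exact: inv_size_ge0.
- apply/trivIsetP => i j _ _ ij; apply/seteqP; split=> // x [/level_uniq h /h].
  by move/eqP: ij.
Qed.

Definition transversal (A : set J) := [/\ measurable A,
  forall x, A x -> finite_set (component F x),
  forall x, finite_set (component F x) -> exists2 r, A r & component F x r &
  forall r r', A r -> A r' -> component F r r' -> r = r'].

(* Every point of a finite component sends its mass to the representative. *)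
Lemma mu_transversal A : sym_edges F -> transversal A ->
  (mu A = \int[mu]_x inv_size R (component F x))%E.
Proof.
move=> sF [mA fA exA uA]; rewrite integral_inv_size.
rewrite [A in mu A](_ : A = \bigcup_n (A `&` level F n)); last first.
  rewrite -setI_bigcupr setIidl// => x /fA/finite_counting[n ln].
  by exists n.
have mAl n : measurable (A `&` level F n).
  by apply: measurableI => //; exact: measurable_level.
rewrite measure_semi_bigcup//; last 2 first.
- apply/trivIsetP => i j _ _ ij; apply/seteqP.
  by split=> // x [[_ /level_uniq h] [_ /h]]; move/eqP: ij.
- exact: bigcupT_measurable.
apply: eq_eseriesr => n _; have [->|n0] := eqVneq n 0%N.
  by rewrite level0 setI0 !measure0 mule0.
(* Edges run from a representative to its whole component: out-degree [n] on the representatives,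
   in-degree 1 on [level F n]. Transport gives [n] times the measure of the former equal to that of
   the latter. *)
pose K := [set p : J * J | (A `&` level F n) p.1 /\ crel F p].
have mK : measurable K.
  apply: msetA; last exact: (measurable_crel G mF FE).
  exact: (mset_pre (A := A `&` level F n) measurable_fst (mAl n)).
have KE : K `<=` crel E by move=> p [_]; exact: crel_mono.
have := mass_transport G mK KE.
rewrite (eq_integral (fun x => (n%:R)%:E * (\1_(A `&` level F n) x)%:E)%E); last first.
  move=> x _; rewrite /deg setTI indicE.
  have [Ax|nAx] := pselect ((A `&` level F n) x).
    rewrite mem_set// mule1 -(Ax.2 : counting _ = _); congr counting.
    by apply/seteqP; split=> y // [].
  rewrite memNset// mule0 (_ : nbhd K x = set0); first exact: measure0.
  by apply/seteqP; split=> // y [].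
rewrite ge0_integralZl//; last by apply/measurable_EFinP; exact: measurable_indic.
rewrite [X in _ = X](eq_integral (fun x => (\1_(level F n) x)%:E)); last first.
  move=> y _; rewrite /deg setTI indicE.
  have [ly|nly] := pselect (level F n y).
    have /exA[r Ar yr] : finite_set (component F y) by apply/finite_counting; exists n.
    rewrite mem_set// (_ : nbhd _ y = [set r]); first exact: counting_set1.
    apply/seteqP; split=> [x [[Ax _] xy]|_ ->] /=.
      by apply: uA => //; exact: component_trans yr.
    split; last exact: component_sym.
    by split=> //; rewrite /level /= -(component_eq sF yr).
  rewrite memNset// (_ : nbhd _ y = set0); first exact: measure0.
  apply/seteqP; split=> // x [[_ lx] xy]; apply: nly.
  by rewrite /level /= -(component_eq sF xy).
rewrite !integral_indic//; last exact: measurable_level.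
rewrite !setIT => <-; rewrite muleA -EFinM mulVf ?mul1e// pnatr_eq0//.
Qed.

End measurability.
End rank.

(** * Increasing unions and null sets of edges *)

Lemma component_bigcup (T : Type) (Fk : nat -> set (T * T)) x y :
  (forall i j, (i <= j)%N -> Fk i `<=` Fk j) ->
  component (\bigcup_k Fk k) x y -> exists k, component (Fk k) x y.
Proof.
move=> ndF; apply: (component_inv (P := fun y => exists k, component (Fk k) x y)).
  by exists 0%N; exact: component_refl.
move=> u v [k xu] [l _ Fuv]; exists (maxn k l).
apply: (component_trans (y := u)).
  by apply: component_mono xu; apply: ndF; exact: leq_maxl.
by apply: component_step; apply: ndF Fuv; exact: leq_maxr.
Qed.

Lemma component_bigcup_finite (T : eqType) (Fk : nat -> set (T * T)) x (s : seq T) :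
  (forall i j, (i <= j)%N -> Fk i `<=` Fk j) ->
  (forall y, y \in s -> component (\bigcup_k Fk k) x y) ->
  exists k0, forall k, (k0 <= k)%N -> forall y, y \in s -> component (Fk k) x y.
Proof.
move=> ndF; elim: s => [|a s IH] hs; first by exists 0%N.
have [k0 h0] := IH (fun y ys => hs y (mem_behead (s := a :: s) ys)).
have [k1 h1] := component_bigcup ndF (hs a (mem_head _ _)).
exists (maxn k0 k1) => k; rewrite geq_max => /andP[k0k k1k] y.
rewrite inE => /predU1P[->|]; last exact: h0.
by apply: component_mono h1; exact: ndF.
Qed.

Section continuity.
Context (d : measure_display) (J : measurableType d) (R : realType)
  (mu : probability J R) (E : set (J * J)) (G : gdata mu E).

Let muT : mu [set: J] = 1%E.
Proof. exact: probability_setT. Qed.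

Lemma graphing_measurable : measurable E.
Proof. by have [_ []] := gdataP G. Qed.

Lemma emeas_lty : (emeas G E < +oo)%E.
Proof.
have [_ _ [D hD] _] := gdataP G.
rewrite -emeasE//; [|exact: graphing_measurable|exact: sub_crel].
apply: (@le_lt_trans _ _ (\int[mu]_x (cst (D%:R)%:E) x)%E).
  apply: ge0_le_integral => //.
  by apply: (measurable_deg G); [exact: graphing_measurable|exact: sub_crel].
by rewrite integral_cst// [X in (_ * X)%E]muT mule1 ltry.
Qed.

Lemma emeas_fin F : measurable F -> F `<=` E -> emeas G F \is a fin_num.
Proof.
move=> mF FE; rewrite ge0_fin_numE//; apply: le_lt_trans emeas_lty.
by apply: le_measure => //; rewrite inE//; exact: graphing_measurable.
Qed.

Lemma edge_measE F : measurable F -> F `<=` E ->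
  edge_meas mu F = ((2^-1)%:E * emeas G F)%E.
Proof. by move=> mF FE; rewrite /edge_meas (emeasE G)//; exact: sub_crel. Qed.

(** A finite limit component is reached after finitely many steps; an infinite one makes the
    approximating components contain any given finite part of it. *)
Lemma inv_size_cvg (Fk : nat -> set (J * J)) x :
  (forall i j, (i <= j)%N -> Fk i `<=` Fk j) ->
  inv_size R (component (Fk k) x) @[k --> \oo] -->
  inv_size R (component (\bigcup_k Fk k) x).
Proof.
move=> ndF; set F := \bigcup_k Fk k.
have sub k : component (Fk k) x `<=` component F x.
  by apply: component_mono => p Fp; exists k.
have [fF|nF] := pselect (finite_set (component F x)).
  have /finite_seqP[s sE] := fF.
  have [k0 h0] : exists k0, forall k, (k0 <= k)%N -> forall y, y \in s -> component (Fk k) x y.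
    by apply: component_bigcup_finite => // y ys; rewrite -/F sE.
  apply: cvg_near_cst; exists k0 => // k /= k0k; congr inv_size.
  by apply/seteqP; split=> // y; rewrite sE => /h0; exact.
rewrite (inv_size_infinite _ nF).
pose r k : R := fine (inv_size R (component (Fk k) x)).
have rE k : inv_size R (component (Fk k) x) = (r k)%:E.
  by rewrite /r /inv_size; case: ifP.
under eq_fun do rewrite rE.
apply: cvg_EFin; first exact: nearW.
(* [n.+1] exceeds [e^-1], so a component with at least [n.+1] points has inverse size below [e]. *)
apply/cvgrPdist_le => e e0; pose n := Num.truncn e^-1.
have [B BF Bn] := infinite_set_fset n.+1 nF.
have [k0 h0] : exists k0, forall k, (k0 <= k)%N -> forall y, y \in enum_fset B -> component (Fk k) x y.
  by apply: component_bigcup_finite => // y yB; exact: BF.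
exists k0 => // k /= k0k; rewrite sub0r normrN /r /inv_size.
case: asboolP => [fk|_] /=; last by rewrite normr0 ltW.
have Bk : (n.+1 <= #|` fset_set (component (Fk k) x)|)%N.
  apply: leq_trans Bn _; apply: fsubset_leq_card; apply/fsubsetP => y yB.
  by rewrite in_fset_set// inE; exact: h0.
rewrite ger0_norm ?invr_ge0// invf_ple ?posrE//; last first.
  by rewrite ltr0n; exact: leq_trans Bk.
apply: ltW; apply: (lt_le_trans (truncnS_gt _)); by rewrite ler_nat.
Qed.

(** The rank passes to the limit by dominated convergence, the edge measure by continuity from
    below. *)
Lemma rank_edge_bigcup (Fk : nat -> set (J * J)) :
  (forall k, measurable (Fk k)) -> (forall k, Fk k `<=` E) ->
  (forall i j, (i <= j)%N -> Fk i `<=` Fk j) ->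
  (forall k, grank mu (Fk k) = edge_meas mu (Fk k)) ->
  grank mu (\bigcup_k Fk k) = edge_meas mu (\bigcup_k Fk k).
Proof.
move=> mF FE ndF rF; set F := \bigcup_k Fk k.
have mFF : measurable F by exact: bigcupT_measurable.
have FFE : F `<=` E by move=> p [k _]; exact: FE.
have c1 : grank mu (Fk k) @[k --> \oo] --> grank mu F.
  apply: cvgeB; [by rewrite fin_num_adde_defr|exact: cvg_cst|].
  have cv : {ae mu, forall x, [set: J] x ->
      inv_size R (component (Fk k) x) @[k --> \oo] --> inv_size R (component F x)}.
    by apply: aeW => x _; exact: inv_size_cvg.
  have le1 : {ae mu, forall x n, [set: J] x ->
      (`|inv_size R (component (Fk n) x)| <= (EFin \o cst 1%R) x)%E}.
    apply: aeW => x n _; rewrite gee0_abs; last exact: inv_size_ge0.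
    by apply: inv_size_le1; exists x; exact: component_refl.
  by have [] := dominated_convergence measurableT
    (fun k => measurable_inv_size G (mF k) (@FE k)) (measurable_inv_size G mFF FFE) cv
    (finite_measure_integrable_cst mu 1 measurableT) le1.
have c2 : edge_meas mu (Fk k) @[k --> \oo] --> edge_meas mu F.
  rewrite edge_measE//; under eq_fun do rewrite edge_measE//.
  apply: cvgeZl => //; apply: nondecreasing_cvg_mu => //.
  by move=> i j ij; apply/subsetPset; exact: ndF.
have e : (fun k => grank mu (Fk k)) = (fun k => edge_meas mu (Fk k)) by exact/funext.
rewrite -e in c2; exact: (cvg_unique (@ereal_hausdorff R) c1 c2).
Qed.

Lemma emeas0P K : measurable K -> K `<=` crel E ->
  emeas G K = 0%E <-> mu [set x | exists y, K (x, y)] = 0%E.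
Proof.
move=> mK KE; rewrite -emeasE//.
have mA : measurable [set x | exists y, K (x, y)].
  rewrite (_ : mkset _ = [set x | exists y, component E x y /\ K (x, y)]).
    apply: (mset_component_ex G (g := id) (P := fun x y => K (x, y))) => //.
    by rewrite (_ : mkset _ = K)//; apply/seteqP; split=> -[].
  apply/seteqP; split=> x [y]; last by move=> [_ Ky]; exists y.
  by move=> Ky; exists y; split=> //; exact: (KE _ Ky).
have h := ae_eq_integral_abs mu measurableT (measurable_deg G mK KE).
have degge0 x : (0 <= deg R K setT x)%E by exact: measure_ge0.
have h' : (\int[mu]_x `|deg R K setT x| = \int[mu]_x deg R K setT x)%E.
  by apply: eq_integral => x _; rewrite gee0_abs.
rewrite -h'; apply: (iff_trans h); split.
  move=> [N [mN N0 sN]]; apply: (@subset_measure0 _ _ _ mu _ N) => //.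
  move=> x [y Ky]; apply: sN => /= /(_ Logic.I); rewrite /deg setTI => c0.
  move: c0; rewrite /counting; case: asboolP => // fK [] /eqP.
  rewrite pnatr_eq0 cardfs_eq0 => /eqP f0.
  have : y \in fset_set (nbhd K x) by rewrite in_fset_set// inE.
  by rewrite f0.
move=> A0; exists [set x | exists y, K (x, y)]; split=> // x /= nx.
apply: contrapT => nK; apply: nx => _; rewrite /deg setTI.
rewrite (_ : nbhd K x = set0) ?measure0//.
by apply/seteqP; split=> // y Ky; apply: nK; exists y.
Qed.

(* Mass transport makes the saturation of a null set null. *)
Lemma null_saturation (N : set J) : measurable N -> mu N = 0%E ->
  measurable [set x | exists y, component E x y /\ N y] /\
  mu [set x | exists y, component E x y /\ N y] = 0%E.
Proof.
move=> mN N0.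
have mC : measurable (crel E) by apply: (measurable_crel G) => //; exact: graphing_measurable.
have mZ : measurable [set x | exists y, component E x y /\ N y].
  apply: (mset_component_ex G (g := id) (P := fun _ y => N y)) => //.
  exact: (mset_pre (A := N) measurable_snd).
split=> //; pose K := [set p : J * J | crel E p /\ N p.1].
have mK : measurable K by apply: msetA => //; exact: (mset_pre (A := N) measurable_fst).
have KE : K `<=` crel E by move=> p [].
have sE : sym_edges E by have [_ []] := gdataP G.
have TE : transpose K `<=` crel E by move=> [x y] [/= c _]; exact: component_sym.
have mT : measurable (transpose K).
  apply: (mset_pre (A := K) (f := fun p : J * J => (p.2, p.1))) => //.
  by apply: measurable_fun_pair; [exact: measurable_snd|exact: measurable_fst].
have K0 : emeas G K = 0%E.
  apply/emeas0P => //; apply: (@subset_measure0 _ _ _ mu _ N) => //.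
    rewrite (_ : mkset _ = N)//; apply/seteqP; split=> x; first by move=> [y []].
    by move=> Nx; exists x; split=> //; exact: component_refl.
  by move=> x [y []].
have T0 : emeas G (transpose K) = 0%E.
  by rewrite -emeasE// -(mass_transport G)// (emeasE G).
move/emeas0P: T0 => /(_ mT TE) T0.
rewrite (_ : mkset _ = [set x | exists y, transpose K (x, y)])//.
apply/seteqP; split=> x [y [xy Ny]]; exists y; split=> //; exact: component_sym.
Qed.

Lemma component_avoid (F N : set (J * J)) x : F `<=` E ->
  (forall y, component E x y -> forall z, ~ N (y, z)) ->
  component (F `\` N) x = component F x.
Proof.
move=> FE nN; apply/seteqP; split; first by apply: component_mono => p [].
move=> y xy; suff [] : component (F `\` N) x y /\ component E x y by [].
move: xy.
apply: (component_inv (P := fun y => component (F `\` N) x y /\ component E x y)).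
  by split; exact: component_refl.
move=> u v [xu Exu] Fuv; have nuv := nN u Exu v; split.
  by apply: component_trans xu _; apply: component_step.
by apply: component_trans Exu _; apply: component_step; exact: FE.
Qed.

(** The exceptional set is the saturation under [E] of the endpoints of [N]. It depends on [N]
    alone, so one null set serves all [F] simultaneously. *)
Lemma ae_component_null (N : set (J * J)) : measurable N -> N `<=` E -> emeas G N = 0%E ->
  {ae mu, forall x F, F `<=` E -> component (F `\` N) x = component F x}.
Proof.
move=> mN NE N0; have NC := sub_crel NE.
have m1 : measurable [set x | exists y, N (x, y)].
  rewrite (_ : mkset _ = [set x | exists y, component E x y /\ N (x, y)]).
    apply: (mset_component_ex G (g := id) (P := fun x y => N (x, y))) => //.
    by rewrite (_ : mkset _ = N)//; apply/seteqP; split=> -[].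
  apply/seteqP; split=> x [y]; last by move=> [_ Ny]; exists y.
  by move=> Ny; exists y; split=> //; exact: (NC _ Ny).
have [mZ Z0] := null_saturation m1 ((emeas0P mN NC).1 N0).
exists [set x | exists y, component E x y /\ exists z, N (y, z)]; split=> // x /= nx.
apply: contrapT => h; apply: nx => F FE; apply: component_avoid => // y xy z Nyz.
by apply: h; exists y; split=> //; exists z.
Qed.

Lemma grank_ae (F F' : set (J * J)) : measurable F -> measurable F' ->
  F `<=` E -> F' `<=` E ->
  {ae mu, forall x, inv_size R (component F x) = inv_size R (component F' x)} ->
  grank mu F = grank mu F'.
Proof.
move=> mF mF' FE FE' h; rewrite /grank; congr (_ - _)%E.
apply: ge0_ae_eq_integral => //; [exact: (measurable_inv_size G)|
  exact: (measurable_inv_size G)|by move=> x _; exact: inv_size_ge0|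
  by move=> x _; exact: inv_size_ge0|].
by apply: filterS h => x -> _.
Qed.

End continuity.

(** * Forests *)

Definition del_edge (T : Type) (F : set (T * T)) (u v : T) : set (T * T) :=
  [set p | F p /\ p <> (u, v) /\ p <> (v, u)].

Definition bridges (T : Type) (F : set (T * T)) :=
  forall u v, F (u, v) -> ~ component (del_edge F u v) u v.

Lemma sym_del_edge (T : Type) (F : set (T * T)) u v :
  sym_edges F -> sym_edges (del_edge F u v).
Proof.
move=> sF x y [Fxy [n1 n2]]; split; first exact: sF.
by split=> -[] ? ?; subst; [apply: n2|apply: n1].
Qed.

Lemma bridges_sub (T : Type) (F F' : set (T * T)) :
  F `<=` F' -> bridges F' -> bridges F.
Proof.
move=> FF' bF' u v /FF'/bF'; apply: contra_not; apply: component_mono.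
by move=> p [/FF' Fp h].
Qed.

(** A detour around an edge uses finitely many edges, so it already exists at a finite stage. *)
Lemma bridges_bigcup (T : Type) (Fk : nat -> set (T * T)) :
  (forall i j, (i <= j)%N -> Fk i `<=` Fk j) -> (forall k, bridges (Fk k)) ->
  bridges (\bigcup_k Fk k).
Proof.
move=> ndF bF u v [k _ Fuv] uv.
have h : component (\bigcup_k del_edge (Fk k) u v) u v.
  by apply: component_mono uv => p [[l _ Fp] h]; exists l.
have nd i j : (i <= j)%N -> del_edge (Fk i) u v `<=` del_edge (Fk j) u v.
  by move=> ij p [Fp np]; split=> //; exact: ndF Fp.
have [l luv] := component_bigcup nd h.
apply: (bF (maxn k l) u v); first by apply: ndF Fuv; exact: leq_maxl.
by apply: component_mono luv; apply: nd; exact: leq_maxr.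
Qed.

Lemma bridges_acyclic (T : Type) (F : set (T * T)) :
  sym_edges F -> bridges F -> acyclic F.
Proof.
move=> sF bF n f [n3 inj edge].
have n0 : (0 < n)%N by exact: leq_trans n3.
have n1 : (1 < n)%N by exact: leq_trans n3.
have E01 : F (f 0%N, f 1%N) by have := edge 0%N n0; rewrite modn_small.
(* The edge between [f 0] and [f 1] is deleted and the cycle is followed the other way, from [f 1]
   up to [f n.-1]; only the final step to [f 0] wraps around. *)
apply: (bF (f 1%N) (f 0%N)); first exact: sF.
have step i : (0 < i < n)%N -> del_edge F (f 1%N) (f 0%N) (f i, f (i.+1 %% n)%N).
  move=> /andP[i0 il]; split; first exact: edge.
  have im : (i.+1 %% n < n)%N by rewrite ltn_mod.
  split=> -[] /inj.
    move=> /(_ il n1) i1 /inj-/(_ im n0); rewrite i1 modn_small//.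
  by move=> /(_ il n0) i1; rewrite i1 in i0.
have reach i : (0 < i < n)%N -> component (del_edge F (f 1%N) (f 0%N)) (f 1%N) (f i).
  elim: i => // -[|i] IH /andP[_ il]; first exact: component_refl.
  apply: component_trans (IH _) _; first by rewrite /= ltnW.
  apply: component_step; have := step i.+1; rewrite modn_small//; apply.
  by rewrite /= ltnW.
have nn : (0 < n.-1 < n)%N by case: (n) n3 => [|[|k]] //= _; exact: ltnSn.
apply: component_trans (reach _ nn) _; apply: component_step.
by have := step _ nn; rewrite prednK// modnn.
Qed.

(** A detour around an edge, shortened to a simple path, closes up to a cycle. It has at least three
    vertices: one is excluded by irreflexivity, two because the edge itself is deleted. *)
Lemma acyclic_bridges (T : eqType) (F : set (T * T)) :
  sym_edges F -> irrefl_edges F -> acyclic F -> bridges F.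
Proof.
move=> sF iF aF u v Fuv.
pose r := [rel a b : T | `[< del_edge F u v (a, b) >]].
move=> /clos_rt_rt1n_iff cuv.
have [p pp lp] : exists2 p, path r u p & last u p = v.
  elim: cuv => [x|x y z xy _ [p pp lp]]; first by exists [::].
  by exists (y :: p) => //=; rewrite pp andbT; exact/asboolP.
case: (shortenP pp) lp => q pq uq _ lq {p pp}.
case: q pq uq lq => [_ _ /= uv|w q]; first by apply: (iF u); rewrite {2}uv.
case: q => [|w' q] pq uq lq.
  by move: pq lq => /=; rewrite andbT => /asboolP[_ [h _]] wv; apply: h; rewrite wv.
set s := [:: u, w, w' & q]; apply: (aF (size s) (nth u s)); split=> //.
  by move=> i j il jl /eqP; rewrite nth_uniq// => /eqP.
move=> i; rewrite ltnS leq_eqVlt => /predU1P[->|il].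
  rewrite modnn nth_last /= -[last _ _]/(last u [:: w, w' & q]) lq.
  exact: sF.
by rewrite modn_small//; have /pathP-/(_ u i il) /asboolP[] := pq.
Qed.

(* Attaching edges: distinct components of F receive at most one outgoing edge of
   X each, and no edge of X ends in a component from which another one starts. *)
Section attach.
Context (T : choiceType) (F X : set (T * T)).
Hypothesis sF : sym_edges F.
Hypothesis X_unique : forall u v u' v', X (u, v) -> X (u', v') ->
  component F u u' -> u = u' /\ v = v'.
Hypothesis X_out : forall u v u' v', X (u, v) -> X (u', v') -> ~ component F u' v.

Definition attach (F' : set (T * T)) := F' `|` (X `|` transpose X).

Definition attached : set T := [set z | exists u v, X (u, v) /\ component F u z].

Lemma sym_attach F' : sym_edges F' -> sym_edges (attach F').
Proof.
move=> sF' x y [/sF'|[]] h; [by left|right; right; exact: h|].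
by right; left; exact: h.
Qed.

Lemma attach_outside F' a z : F' `<=` F -> ~ attached a ->
  component (attach F') a z -> (~ attached z -> component F' a z) /\
    forall u v, X (u, v) -> component F u z -> component F' a v.
Proof.
move=> F'F na; apply: (component_inv (P := fun z =>
  (~ attached z -> component F' a z) /\
    forall u v, X (u, v) -> component F u z -> component F' a v)).
  split=> [_|u v Xuv ua]; first exact: component_refl.
  by exfalso; apply: na; exists u, v.
move=> y z' [Py1 Py2] [Fyz|[Xyz|Xzy]].
- split=> [nz|u v Xuv uz].
    apply: component_trans (Py1 _) (component_step Fyz) => -[u [v [Xuv uy]]].
    apply: nz; exists u, v; split=> //; apply: component_trans uy _.
    exact/component_step/F'F.
  apply: (Py2 u) => //; apply: component_trans uz _.
  by apply: component_sym => //; exact/component_step/F'F.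
- split=> [_|u v Xuv uz]; first exact: (Py2 _ _ Xyz (component_refl _ _)).
  by have := X_out Xyz Xuv.
- have cy : component F' a y.
    by apply: Py1 => -[u [v [Xuv uy]]]; have := X_out Xzy Xuv.
  split=> [nz|u v Xuv uz].
    by exfalso; apply: nz; exists z', y; split=> //; exact: component_refl.
  by have [_ ->] := X_unique Xuv Xzy uz.
Qed.

(** A path starting in an attached component stays there or leaves through the only exit [v]. *)
Lemma attach_inside F' a u v z : F' `<=` F -> X (u, v) -> component F u a ->
  component (attach F') a z -> component F u z \/ component (attach F') v z.
Proof.
move=> F'F Xuv ua; apply: (component_inv (P := fun z =>
  component F u z \/ component (attach F') v z)); first by left.
move=> y z' [uy|vy] h; last by right; apply: component_trans vy (component_step h).
case: h => [Fyz|[Xyz|Xzy]].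
- by left; apply: component_trans uy _; exact/component_step/F'F.
- by have [_ <-] := X_unique Xuv Xyz uy; right; exact: component_refl.
- by have := X_out Xzy Xuv.
Qed.

Lemma attach_reach u v z : X (u, v) -> component F u z -> component (attach F) z v.
Proof.
move=> Xuv uz; apply: (component_trans (y := u)).
  apply: (component_mono (F := F)); first by move=> p Fp; left.
  exact: component_sym.
by apply: component_step; right; left.
Qed.

(** A new edge is the only exit of its component. A detour around an old edge may have its
    excursions through new edges cut out, which leaves a detour within [F]. *)
Lemma bridges_attach : bridges F -> bridges (attach F).
Proof.
move=> bF.
have newX u v : X (u, v) -> ~ component (del_edge (attach F) u v) u v.
  move=> Xuv uv; apply: (X_out Xuv Xuv); move: uv.
  apply: component_inv; first exact: component_refl.
  move=> y z uy [[Fyz|[Xyz|Xzy]] [n1 n2]].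
  - exact: component_trans uy (component_step Fyz).
  - by have [uE vE] := X_unique Xuv Xyz uy; subst; case: n1.
  - by have := X_out Xzy Xuv.
move=> a b [Fab|[Xab|Xba]] ab; last 2 first.
- exact: newX ab.
- apply: (newX _ _ Xba); apply: component_sym.
    by apply: sym_del_edge; exact: sym_attach.
  by apply: component_mono ab => p [h [n1 n2]].
apply: (bF _ _ Fab); set F' := del_edge F a b.
have F'F : F' `<=` F by move=> p [].
have {}ab : component (attach F') a b.
  apply: component_mono ab => p [[Fp h|]]; last by right.
  by left.
have [[u [v [Xuv ua]]]|na] := pselect (attached a); last first.
  have [+ _] := attach_outside F'F na ab; apply.
  move=> [u [v [Xuv ub]]]; apply: na; exists u, v; split=> //.
  by apply: component_trans ub _; apply: component_step; exact: sF.
(* Invariant along the path: inside the [F]-component of [u] the vertex is reached within [F'];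
   outside it, the path has left through [u], so [u] is reached within [F']. *)
have : (component F u b -> component F' a b) /\ (~ component F u b -> component F' a u).
  move: ab; apply: (component_inv (P := fun z =>
    (component F u z -> component F' a z) /\ (~ component F u z -> component F' a u))).
    by split=> // _; exact: component_refl.
  move=> y z [P1 P2] [Fyz|[Xyz|Xzy]].
  - have Fuz : component F u y <-> component F u z.
      split=> h; apply: component_trans h _; last apply: component_sym => //;
        exact/component_step/F'F.
    split=> [/Fuz/P1 h|]; first exact: component_trans h (component_step Fyz).
    by move=> nz; apply: P2 => /Fuz.
  - split=> [/(X_out Xyz Xuv)//|_].
    have [uy|/P2//] := pselect (component F u y).
    by have [uE _] := X_unique Xuv Xyz uy; rewrite uE; apply: P1; rewrite uE; exact: component_refl.
  - have au : component F' a u by apply: P2; exact: X_out Xzy Xuv.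
    by split=> // uz; have [<- _] := X_unique Xuv (Xzy : X (z, y)) uz.
by case=> + _; apply; apply: component_trans ua (component_step Fab).
Qed.

Hypothesis X_finite : forall u v, X (u, v) -> finite_set (component F u).
Hypothesis X_deg : forall v, finite_set [set u | X (u, v)].

(** The new component is the old one with finitely many finite components hung on each of its
    vertices. *)
Lemma finite_attach_outside F' a : F' `<=` F -> ~ attached a ->
  finite_set (component F' a) -> finite_set (component (attach F') a).
Proof.
move=> F'F na fa; pose A := component F' a `|`
  \bigcup_(v in component F' a) \bigcup_(u in [set u | X (u, v)]) component F u.
apply: (@sub_finite_set _ _ A).
  move=> z /(attach_outside F'F na)[h1 h2].
  have [[u [v [Xuv uz]]]|nz] := pselect (attached z); last by left; exact: h1.
  by right; exists v; [exact: h2 Xuv uz|exists u].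
rewrite finite_setU; split=> //; apply: bigcup_finite => // v _.
by apply: bigcup_finite => // u /X_finite.
Qed.

Lemma finite_attach F' : F' `<=` F -> (forall a, finite_set (component F' a)) ->
  forall a, finite_set (component (attach F') a).
Proof.
move=> F'F fF' a.
have [[u [v [Xuv ua]]]|na] := pselect (attached a); last exact: finite_attach_outside.
have nv : ~ attached v by move=> [u' [v' [Xuv']]]; exact: X_out Xuv Xuv'.
apply: (@sub_finite_set _ _ (component F u `|` component (attach F') v)).
  by move=> z /(attach_inside F'F Xuv ua).
rewrite finite_setU; split; first exact: X_finite Xuv.
exact: finite_attach_outside.
Qed.

End attach.

(** * Growing hyperfinite forests *)

Lemma seq_argmin (T : eqType) (R : realType) (f : T -> R) x (s : seq T) :
  exists2 m, m \in x :: s & forall y, y \in x :: s -> f m <= f y.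
Proof.
elim: s x => [|a s IH] x.
  by exists x; [exact: mem_head|move=> y; rewrite inE => /eqP ->].
have [m ms mmin] := IH a; have [xm|/ltW mx] := lerP (f x) (f m).
  exists x; first exact: mem_head.
  move=> y; rewrite inE => /predU1P[->//|/mmin]; exact: le_trans.
exists m; first by rewrite inE ms orbT.
by move=> y; rewrite inE => /predU1P[->//|/mmin].
Qed.

Section grow.
Context (d : measure_display) (J : measurableType d) (R : realType)
  (mu : probability J R) (E : set (J * J)) (G : gdata mu E).

Lemma graphing_sym : sym_edges E.
Proof. by have [_ []] := gdataP G. Qed.

Lemma graphing_irrefl : irrefl_edges E.
Proof. by have [_ []] := gdataP G. Qed.

Lemma graphing_finite x : finite_set (nbhd E x).
Proof.
have [_ _ [D hD] _] := gdataP G.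
by have := hD x; rewrite /deg setTI => /counting_le_card[].
Qed.

(** Finite components missed by [U] are represented by their [f]-least point, for the Borel
    injection [f] into the reals: finiteness gives existence, injectivity gives uniqueness. *)
Lemma transversal_extend F (U : set J) : measurable F -> F `<=` E -> sym_edges F ->
  measurable U -> (forall x, U x -> finite_set (component F x)) ->
  (forall r r', U r -> U r' -> component F r r' -> r = r') ->
  exists2 V, transversal F V & U `<=` V.
Proof.
move=> mF FE sF mU fU uU; have [[f [injf [mf _]]] _ _ _] := gdataP G.
have mC := measurable_crel G mF FE.
pose V0 := [set x | finite_set (component F x) /\
  ((forall y, component E x y -> component F x y -> ~ U y) /\
   (forall y, component E x y -> component F x y -> f x <= f y))].
have mid : measurable_fun setT (@id J) by exact: measurable_id.
have mV0 : measurable V0.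
  apply: msetA; first exact: (measurable_finite_component G mF FE).
  apply: msetA.
    apply: (mset_component_all G (g := id) (P := fun x y => component F x y -> ~ U y)) => //.
    by apply: msetI => //; apply: msetN; exact: (mset_pre (A := U) measurable_snd).
  apply: (mset_component_all G (g := id)
    (P := fun x y => component F x y -> f x <= f y)) => //.
  apply: msetI => //.
  rewrite (_ : mkset _ = [set p : J * J | forall q : rat,
      real_code (f p.2) (pickle q) -> real_code (f p.1) (pickle q)]).
    have [_ mr _ _] := coded_real R.
    have m1 (g : J * J -> J) n : measurable_fun setT g ->
        measurable [set p : J * J | real_code (f (g p)) n].
      move=> mg; apply: (mset_pre (A := fun z : cantorM => z n)
        (f := fun p => real_code (f (g p)))); last exact: measurable_coord.
      by apply: (measurableT_comp mr); exact: measurableT_comp.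
    apply: mset_all => q; apply: msetI; apply: m1.
      exact: measurable_snd.
    exact: measurable_fst.
  apply/seteqP; split=> -[x y] /=.
    by move=> xy q; rewrite !real_codeE; exact: le_lt_trans.
  move=> h; rewrite leNgt; apply/negP => /rat_in_itvoo[q].
  rewrite in_itv /= => /andP[yq qx]; have := h q; rewrite !real_codeE => /(_ yq).
  by rewrite ltNge (ltW qx).
have FEc x y : component F x y -> component E x y by exact: component_mono.
exists (U `|` V0); last by move=> x Ux; left.
split.
- exact: measurableU.
- by move=> x [/fU|[]].
- move=> x fx; have [[y [Uy xy]]|nU] := pselect (exists y, U y /\ component F x y).
    by exists y => //; left.
  have /finite_seqP[s sE] := fx.
  have [m ms mmin] := seq_argmin f x s.
  have xm : component F x m.
    move: ms; rewrite inE => /predU1P[->|ms]; first exact: component_refl.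
    by rewrite sE.
  exists m => //; right; split; first by rewrite -(component_eq sF xm).
  split=> y _ my; first by move=> Uy; apply: nU; exists y; split=> //; exact: component_trans xm my.
  apply: mmin; rewrite inE; apply/orP; right.
  by have : component F x y by [exact: component_trans xm my]; rewrite sE.
- move=> r r' [Ur|[fr [nr minr]]] [Ur'|[fr' [nr' minr']]] rr'.
  + exact: uU.
  + by have := nr' r (FEc _ _ (component_sym sF rr')) (component_sym sF rr').
  + by have := nr r' (FEc _ _ rr') rr'.
  + apply: injf; apply/eqP; rewrite eq_le minr ?minr'//=; try exact: FEc.
      exact: (FEc _ _ (component_sym sF rr')).
    exact: component_sym.
Qed.

Definition good F := [/\ measurable F, sym_edges F, F `<=` E, bridges F &
  hyperfinite mu F /\ grank mu F = edge_meas mu F].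

Section outgoing.
Variables (A F : set (J * J)) (s t : seq bool).
Local Notation cylG := (cyl (gcode G)).

(** A finite component takes part if it avoids the cylinder [s] and exactly one edge of [A] leads
    from its points in [t] to [s]; that edge is the one attached. Targets lie in [s] and
    participating components avoid [s], so attachments never chain. *)
Definition outgoing : set (J * J) := [set p | [/\ A p, cylG t p.1, cylG s p.2,
  finite_set (component F p.1) /\ (forall y, component F p.1 y -> ~ cylG s y) &
  forall u v, component F p.1 u -> cylG t u -> A (u, v) -> cylG s v ->
    u = p.1 /\ v = p.2]].

Lemma outgoing_unique u v u' v' : outgoing (u, v) -> outgoing (u', v') ->
  component F u u' -> u = u' /\ v = v'.
Proof. by move=> [_ _ _ _ h] [/= A' t' s' _ _] /h-/(_ v' t' A' s')[]. Qed.

Lemma outgoing_out u v u' v' : outgoing (u, v) -> outgoing (u', v') ->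
  ~ component F u' v.
Proof. by move=> [_ _ sv _ _] [_ _ _ [_ h] _] /h. Qed.

Lemma outgoing_finite u v : outgoing (u, v) -> finite_set (component F u).
Proof. by case=> _ _ _ []. Qed.

Hypotheses (mA : measurable A) (AE : A `<=` E) (mF : measurable F) (FE : F `<=` E).

Lemma outgoing_deg v : finite_set [set u | outgoing (u, v)].
Proof.
apply: (@sub_finite_set _ _ (nbhd E v)); last exact: graphing_finite.
by move=> u [/AE Euv _ _ _ _]; exact: graphing_sym.
Qed.

Lemma measurable_outgoing : measurable outgoing.
Proof.
have [_ mc _ _] := gcodeP G.
have mcyl r := @measurable_cyl _ _ _ r mc.
have mC := measurable_crel G mF FE.
rewrite (_ : outgoing = [set p | (A p /\ (cylG t p.1 /\ cylG s p.2)) /\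
  ((finite_set (component F p.1) /\
    forall y, component E p.1 y -> (crel F (p.1, y) -> ~ cylG s y)) /\
   forall u, component E p.1 u -> (crel F (p.1, u) -> (cylG t u ->
     forall v, component E u v -> (A (u, v) -> (cylG s v -> u = p.1 /\ v = p.2)))))]).
  have m1 := @measurable_fst _ _ J J; have m2 := @measurable_snd _ _ J J.
  apply: msetA; apply: msetA => //; last 1 first.
  - apply: (mset_component_all G (g := fst) (P := fun p u => crel F (p.1, u) -> (cylG t u ->
     forall v, component E u v -> (A (u, v) -> (cylG s v -> u = p.1 /\ v = p.2))))) => //.
    have f1 := @measurable_fst _ _ (J * J)%type J.
    have f2 := @measurable_snd _ _ (J * J)%type J.
    have g1 := measurableT_comp m1 f1; have g2 := measurableT_comp m2 f1.
    apply: msetI; first exact: (mset_pre (A := crel F) (measurable_fun_pair g1 f2)).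
    apply: msetI; first exact: (mset_pre (A := cylG t) f2 (mcyl t)).
    apply: (mset_component_all G (g := snd)
      (P := fun q v => A (q.2, v) -> (cylG s v -> q.2 = q.1.1 /\ v = q.1.2))) => //.
    have h1 := @measurable_fst _ _ ((J * J) * J)%type J.
    have h2 := @measurable_snd _ _ ((J * J) * J)%type J.
    have k2 := measurableT_comp f2 h1.
    have k11 := measurableT_comp g1 h1; have k12 := measurableT_comp g2 h1.
    apply: msetI; first exact: (mset_pre (A := A) (measurable_fun_pair k2 h2)).
    apply: msetI; first exact: (mset_pre (A := cylG s) h2 (mcyl s)).
    have meq := measurable_eq G.
    apply: msetA.
      exact: (mset_pre (A := fun p : J * J => p.1 = p.2) (measurable_fun_pair k2 k11)).
    exact: (mset_pre (A := fun p : J * J => p.1 = p.2) (measurable_fun_pair h2 k12)).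
  - by apply: msetA; [exact: (mset_pre (A := cylG t) m1 (mcyl t))|exact: (mset_pre (A := cylG s) m2 (mcyl s))].
  - apply: msetA.
      exact: (mset_pre (A := fun x => finite_set (component F x)) m1
        (measurable_finite_component G mF FE)).
    apply: (mset_component_all G (g := fst) (P := fun p y => crel F (p.1, y) -> ~ cylG s y)) => //.
    have f1 := @measurable_fst _ _ (J * J)%type J.
    have f2 := @measurable_snd _ _ (J * J)%type J.
    have g1 := measurableT_comp m1 f1.
    apply: msetI; first exact: (mset_pre (A := crel F) (measurable_fun_pair g1 f2)).
    by apply: msetN; exact: (mset_pre (A := cylG s) f2 (mcyl s)).
apply/seteqP; split=> -[x y] /=.
  move=> [Ap tp sp [fp np] up]; do !split=> //.
  - by move=> z _; exact: np.
  - by have [] := up u v.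
  - by have [] := up u v.
move=> [[Ap [tp sp]] [[fp np] up]]; split=> //.
  by split=> // z xz; apply: np => //; exact: component_mono xz.
move=> u v xu tu Auv sv; apply: up => //; first exact: component_mono xu.
by apply: component_step; exact: AE.
Qed.

Hypotheses (sF : sym_edges F) (sA : sym_edges A) (FA : F `<=` A).

Definition grow := attach outgoing F.

Lemma grow_sub : grow `<=` A.
Proof. by move=> [x y] [/FA//|[[]//|[/sA]]]. Qed.

Lemma sub_grow : F `<=` grow.
Proof. by move=> p Fp; left. Qed.

Let OE : outgoing `<=` E.
Proof. by move=> p [/AE]. Qed.

Let TE : transpose outgoing `<=` E.
Proof. by move=> [x y] [/AE Eyx _ _ _ _]; exact: graphing_sym. Qed.

Let mT : measurable (transpose outgoing).
Proof.
apply: (mset_pre (A := outgoing) (f := fun p : J * J => (p.2, p.1))).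
  by apply: measurable_fun_pair; [exact: measurable_snd|exact: measurable_fst].
exact: measurable_outgoing.
Qed.

Lemma measurable_grow : measurable grow.
Proof.
by apply: measurableU => //; apply: measurableU => //; exact: measurable_outgoing.
Qed.

(** The same cut set [S] works: all new edges can be kept, since each hangs a finite component on
    another component and only finitely many meet a given vertex. *)
Lemma hyperfinite_grow : hyperfinite mu F -> hyperfinite mu grow.
Proof.
move=> hF e e0; have [S [mS sS SF eS fS]] := hF e e0.
exists S; split=> //; first by move=> p /SF; exact: sub_grow.
move=> x; apply: (@sub_finite_set _ _ (component (attach outgoing (F `\` S)) x)).
  apply: component_mono => p [[Fp nS|]]; last by right.
  by left.
apply: (finite_attach (F := F)) => //.
- exact: outgoing_unique.
- exact: outgoing_out.
- exact: outgoing_finite.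
- exact: outgoing_deg.
Qed.

Let U := [set u | exists v, outgoing (u, v)].

Let mU : measurable U.
Proof.
rewrite (_ : U = [set u | exists v, component E u v /\ outgoing (u, v)]).
  apply: (mset_component_ex G (g := id) (P := fun u v => outgoing (u, v))) => //.
  rewrite (_ : mkset _ = outgoing); first exact: measurable_outgoing.
  by apply/seteqP; split=> -[].
apply/seteqP; split=> u [v]; last by move=> [_ h]; exists v.
by move=> h; exists v; split=> //; apply: component_step; exact: OE.
Qed.

Lemma emeas_outgoing : emeas G outgoing = mu U.
Proof.
rewrite -emeasE; [|exact: measurable_outgoing|exact: sub_crel].
rewrite (eq_integral (fun x => (\1_U x)%:E)); first by rewrite integral_indic// setIT.
move=> u _; rewrite /deg setTI indicE.
have [[v Xuv]|nU] := pselect (U u).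
  rewrite mem_set; last by exists v.
  rewrite (_ : nbhd _ u = [set v]); first exact: counting_set1.
  apply/seteqP; split=> [w Xuw|_ ->//] /=.
  by have [] := outgoing_unique Xuw Xuv (component_refl _ _).
rewrite memNset// (_ : nbhd _ u = set0); first exact: measure0.
by apply/seteqP; split=> // v Xuv; apply: nU; exists v.
Qed.

(** Each attaching vertex accounts for one edge in either orientation, so its measure enters
    twice. *)
Lemma emeas_grow : emeas G grow = (emeas G F + (mu U + mu U))%E.
Proof.
have mO := measurable_outgoing.
have OT : outgoing `&` transpose outgoing = set0.
  apply/seteqP; split=> // -[x y] [Xxy Xyx].
  exact: (outgoing_out Xxy Xyx (component_refl _ _)).
have FO : F `&` (outgoing `|` transpose outgoing) = set0.
  apply/seteqP; split=> // -[x y] [Fxy [Xxy|Xyx]].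
    exact: (outgoing_out Xxy Xxy (component_step Fxy)).
  exact: (outgoing_out Xyx Xyx (component_step (sF Fxy))).
have eT : emeas G (transpose outgoing) = mu U.
  have OC := sub_crel OE; have TC := sub_crel TE.
  by rewrite -emeasE// -(mass_transport G)// (emeasE G)// emeas_outgoing.
rewrite /grow /attach measureU//; last exact: measurableU.
by rewrite measureU//; congr (_ + (_ + _))%E; [exact: emeas_outgoing|exact: eT].
Qed.

(** An attached component merges into that of its target and gives up its representative. Since [V]
    contains [U], this representative is the attaching vertex itself. *)
Lemma transversal_grow V : transversal F V -> U `<=` V -> transversal grow (V `\` U).
Proof.
move=> [mV fV exV uV] UV.
have out x : V x -> ~ U x -> ~ attached F outgoing x.
  move=> Vx nUx [u [v [Xuv ux]]]; apply: nUx.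
  by rewrite -(uV u x _ Vx ux); [exists v|apply: UV; exists v].
have notv u v : outgoing (u, v) -> ~ attached F outgoing v.
  by move=> Xuv [u' [v' [Xuv']]]; exact: outgoing_out Xuv Xuv'.
split.
- exact: measurableD.
- move=> x [Vx nUx]; apply: (finite_attach_outside (F := F)) => //.
  + exact: outgoing_unique.
  + exact: outgoing_out.
  + exact: outgoing_finite.
  + exact: outgoing_deg.
  + exact: out.
  + exact: fV.
- have ex x : ~ attached F outgoing x -> finite_set (component grow x) ->
      exists2 r, (V `\` U) r & component grow x r.
    move=> nx fx; have [|r Vr xr] := exV x.
      by apply: sub_finite_set fx; apply: component_mono; exact: sub_grow.
    exists r; last by apply: component_mono xr; exact: sub_grow.
    split=> // -[v Xrv]; apply: nx; exists r, v; split=> //.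
    exact: component_sym.
  move=> x fx; have [[u [v [Xuv ux]]]|nx] := pselect (attached F outgoing x); last exact: ex.
  have xv : component grow x v by exact: (attach_reach sF Xuv ux).
  have [|r Vr vr] := ex v (notv _ _ Xuv).
    apply: sub_finite_set fx => z; exact: component_trans xv.
  by exists r => //; exact: component_trans xv vr.
- move=> r r' [Vr nUr] [Vr' nUr'] rr'; apply: uV => //.
  have [+ _] := attach_outside sF outgoing_unique outgoing_out (@subset_refl _ F)
    (out _ Vr nUr) rr'.
  by apply; exact: out.
Qed.

Lemma good_grow : good F -> good grow.
Proof.
move=> [_ _ _ bF [hF rF]]; have gE : grow `<=` E.
  exact: subset_trans grow_sub AE.
have sg : sym_edges grow by exact: sym_attach.
split=> //; first exact: measurable_grow.
  apply: bridges_attach => //; [exact: outgoing_unique|exact: outgoing_out].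
split; first exact: hyperfinite_grow.
have [V tV UV] : exists2 V, transversal F V & U `<=` V.
  apply: transversal_extend => //.
    by move=> u [v]; exact: outgoing_finite.
  by move=> u u' [v Xuv] [v' Xuv'] uu'; have [] := outgoing_unique Xuv Xuv' uu'.
have mV : measurable V by case: tV.
have VF := mu_transversal G mF FE sF tV.
have Vg := mu_transversal G measurable_grow gE sg (transversal_grow tV UV).
have VU : mu (V `\` U) = (mu V - mu U)%E.
  rewrite -[in RHS](setIidr UV); apply: measureD => //.
  by rewrite ltey_eq fin_num_measure.
rewrite (edge_measE G measurable_grow gE) emeas_grow /grank -Vg VU.
move: rF; rewrite (edge_measE G mF FE) /grank -VF.
have := emeas_fin G mF FE; have : mu V \is a fin_num by exact: fin_num_measure.
have : mu U \is a fin_num by exact: fin_num_measure.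
move: (mu U) (mu V) (emeas G F) => [a| |]// [b| |]// [c| |]// _ _ _.
rewrite -EFinB -EFinM => -[h]; rewrite -!EFinD -EFinM. congr (_%:E).
by rewrite mulrDr -h /=; field.
Qed.

End outgoing.
End grow.

(** * The limit of all stages and its finite components *)

Section spanning.
Context (d : measure_display) (J : measurableType d) (R : realType)
  (mu : probability J R) (E : set (J * J)) (G : gdata mu E).

Lemma hyperfinite_bigcup (Fk : nat -> set (J * J)) :
  (forall k, measurable (Fk k)) -> (forall k, sym_edges (Fk k)) ->
  (forall k, Fk k `<=` E) -> (forall i j, (i <= j)%N -> Fk i `<=` Fk j) ->
  (forall k, hyperfinite mu (Fk k)) -> hyperfinite mu (\bigcup_k Fk k).
Proof.
move=> mF sF FE ndF hF e e0; set F := \bigcup_k Fk k.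
have mFF : measurable F by exact: bigcupT_measurable.
have FFE : F `<=` E by move=> p [k _]; exact: FE.
have mD k : measurable (F `\` Fk k) by exact: measurableD.
have DE k : F `\` Fk k `<=` E by move=> p [/FFE].
have cv : emeas G (F `\` Fk k) @[k --> \oo] --> 0%E.
  have -> : 0%E = emeas G (\bigcap_k (F `\` Fk k)).
    rewrite (_ : \bigcap_k _ = set0) ?measure0//.
    by apply/seteqP; split=> // p h; have [[k _ Fp] _] := h 0%N Logic.I; have [] := h k Logic.I.
  apply: nonincreasing_cvg_mu => //.
  - by rewrite ltey_eq emeas_fin.
  - exact: bigcapT_measurable.
  - by move=> i j ij; apply/subsetPset => p [Fp nFp]; split=> // /(ndF _ _ ij).
(* In edge measure the remainder costs at most [e / 2], since [emeas] counts twice; the other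
   [e / 2] is left for cutting [Fk k]. *)
have [k Dk] : exists k, (emeas G (F `\` Fk k) <= e%:E)%E.
  have /fine_cvgP[_ /cvgrPdist_le/(_ e e0)[k _ /(_ k (leqnn k))]] := cv.
  rewrite /= sub0r normrN ger0_norm ?fine_ge0// => h; exists k.
  by rewrite -(@fineK _ (emeas G _)) ?emeas_fin// lee_fin.
have e20 : 0 < e / 2 by rewrite divr_gt0.
have [S [mS sS SF eS fS]] := hF k _ e20.
have SE : S `<=` E by exact: subset_trans SF (@FE k).
exists (S `|` (F `\` Fk k)); split.
- exact: measurableU.
- move=> x y [/sS h|[[l _ Fl] nF]]; [by left|right; split; first by exists l => //; exact: sF].
  by move=> /sF.
- by move=> p [/SF Fp|[]//]; exists k.
- have UE : S `|` (F `\` Fk k) `<=` E by rewrite subUset.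
  rewrite (edge_measE G)//; last exact: measurableU.
  rewrite (edge_measE G)// in eS.
  apply: (@le_trans _ _ ((2^-1)%:E * (emeas G S + emeas G (F `\` Fk k)))%E).
    apply: lee_wpmul2l; first by rewrite lee_fin invr_ge0.
    exact: measureU2.
  move: eS Dk; rewrite -(@fineK _ (emeas G S)) ?emeas_fin//.
  rewrite -(@fineK _ (emeas G (F `\` _))) ?emeas_fin//.
  rewrite -EFinD -!EFinM !lee_fin => h1 h2; lra.
- move=> x; apply: sub_finite_set (fS x); apply: component_mono => p [Fp np].
  split; last by move=> Sp; apply: np; left.
  by apply: contrapT => nF; apply: np; right.
Qed.

Lemma good_bigcup (Fk : nat -> set (J * J)) :
  (forall i j, (i <= j)%N -> Fk i `<=` Fk j) -> (forall k, good mu E (Fk k)) ->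
  good mu E (\bigcup_k Fk k).
Proof.
move=> ndF gF; split.
- by apply: bigcupT_measurable => k; case: (gF k).
- by move=> x y [k _ Fk_]; exists k => //; case: (gF k) => _ + _ _ _; apply.
- by move=> p [k _]; case: (gF k) => _ _ + _ _; apply.
- by apply: bridges_bigcup => // k; case: (gF k).
- split; first by apply: hyperfinite_bigcup => // k; case: (gF k) => ? ? ? ? [].
  by apply: (rank_edge_bigcup G) => // k; case: (gF k) => ? ? ? ? [].
Qed.

Lemma component0 (x : J) : component set0 x = [set x].
Proof.
apply/seteqP; split=> [y|_ ->]; last exact: component_refl.
exact: (component_inv (P := fun y => y = x)).
Qed.

Lemma good0 : good mu E set0.
Proof.
have e0 : edge_meas mu set0 = 0%E by rewrite (edge_measE G)// measure0 mule0.
split=> //; split.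
  move=> e ep; exists set0; split=> //; first by rewrite e0 lee_fin ltW.
  by move=> x; rewrite set0D component0.
rewrite e0 /grank (eq_integral (cst 1%E)).
  rewrite integral_cst// (_ : (1 * _)%E = 1%E) ?subee//.
  by rewrite mul1e; exact: probability_setT.
move=> x _; rewrite component0 /inv_size asboolT//.
by rewrite fset_set1 cardfs1 invr1.
Qed.

(** The exponent of 2 in [n] takes every value infinitely often, so every pair of cylinders recurs
    at arbitrarily late stages. *)
Definition stage_index n : seq bool * seq bool := odflt ([::], [::]) (unpickle (logn 2 n)).

Lemma stage_index_often st n0 : exists2 n, (n0 <= n)%N & stage_index n = st.
Proof.
exists (2 ^ pickle st * n0.*2.+1)%N.
  apply: leq_trans (leq_pmull _ _); last by rewrite expn_gt0.
  by rewrite -addnn leqW// leq_addl.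
rewrite /stage_index lognM ?expn_gt0// pfactorK// logn_coprime ?addn0 ?pickleK//.
by rewrite coprime2n /= odd_double.
Qed.

(* A finite component that can still be left has, for suitable cylinders s and t,
   a single edge leaving it between t and s; it is added when the stage (s, t)
   recurs after the component has stabilized. *)
Lemma extend A F0 : measurable A -> sym_edges A -> A `<=` E -> good mu E F0 -> F0 `<=` A ->
  exists T, [/\ good mu E T, F0 `<=` T, T `<=` A &
    forall x, finite_set (component T x) -> component T x = component A x].
Proof.
move=> mA sA AE gF0 F0A.
pose Tk := fix Tk n := if n is n'.+1 then
  grow G A (Tk n') (stage_index n').1 (stage_index n').2 else F0.
have TkP n : good mu E (Tk n) /\ Tk n `<=` A.
  elim: n => [//|n [gn An]]; have [mn sn En _ _] := gn; split.
    exact: good_grow.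
  exact: grow_sub.
have ndS n : Tk n `<=` Tk n.+1 by exact: sub_grow.
have nd i j : (i <= j)%N -> Tk i `<=` Tk j.
  move=> /subnK <-; elim: (j - i)%N => [//|k IH]; rewrite addSn.
  exact: subset_trans IH (@ndS _).
exists (\bigcup_k Tk k); split.
- by apply: good_bigcup => // k; case: (TkP k).
- by move=> p Fp; exists 0%N.
- by move=> p [k _]; case: (TkP k) => _; apply.
set T := \bigcup_k Tk k => x fx; apply/seteqP; split.
  by apply: component_mono => p [k _]; case: (TkP k) => _; apply.
move=> y; apply: (component_inv (P := component T x)); first exact: component_refl.
move=> u v xu Auv; apply: contrapT => nxv.
have /finite_seqP[K KE] := fx.
have KP z : z \in K <-> component T x z by rewrite KE.
have /finite_seqP[L LE] := graphing_finite G u.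
have [ic _ _ _] := gcodeP G.
(* [s] has to miss the component and every neighbour of [u] other than [v]; [t] has to miss every
   point of the component other than [u]. Then [(u, v)] is the only candidate edge. *)
have : v \notin K ++ rem v (undup L).
  rewrite mem_cat negb_or mem_rem_uniqF ?undup_uniq// andbT.
  by apply/negP => /KP.
move=> /(cyl_separates ic)[s [sv sK]].
have : u \notin rem u (undup K) by rewrite mem_rem_uniqF// undup_uniq.
move=> /(cyl_separates ic)[t [tu tK]].
have [n0 hn0] : exists n0, forall k, (n0 <= k)%N -> forall z, z \in K -> component (Tk k) x z.
  by apply: component_bigcup_finite => // z /KP.
have [n n0n stn] := stage_index_often (s, t) n0.
have [[mn sn En _ _] An] := TkP n.
have xE : component (Tk n) x = component T x.
  apply/seteqP; split=> z; first by apply: component_mono => p Tp; exists n.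
  by move=> /KP; exact: hn0.
have uE : component (Tk n) u = component T x.
  by rewrite -(component_eq sn (_ : component (Tk n) x u)) xE.
apply: nxv; apply: component_trans xu _; apply: component_step.
exists n.+1 => //; right; left; rewrite stn; split=> //=.
- rewrite uE; split=> // z /KP zK sz; apply: (sK z) => //.
  by rewrite mem_cat zK.
- move=> u' v'; rewrite uE => /KP u'K tu' Auv' sv'.
  have u'u : u' = u.
    apply: contrapT => /eqP ne; apply: (tK u') => //.
    by rewrite mem_rem_uniq ?undup_uniq// !inE ne mem_undup.
  split=> //; apply: contrapT => /eqP ne; apply: (sK v') => //.
  rewrite mem_cat mem_rem_uniq ?undup_uniq// !inE ne mem_undup /=; apply/orP; right.
  by have : nbhd E u v' by [apply: AE; rewrite -u'u]; rewrite LE.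
Qed.

Lemma good_finite_forest A : measurable A -> sym_edges A -> A `<=` E -> bridges A ->
  (forall x, finite_set (component A x)) -> good mu E A.
Proof.
move=> mA sA AE bA fA; have [T [gT _ TA spT]] := extend mA sA AE good0 (@sub0set _ _).
have [_ sT _ _ _] := gT.
rewrite (_ : A = T)//; apply/seteqP; split=> // -[u v] Auv.
apply: contrapT => nT; apply: (bA _ _ Auv).
have : component T u v.
  rewrite spT; first exact: component_step.
  by apply: sub_finite_set (fA u); exact: component_mono.
apply: component_mono => p Tp; split; first exact: TA.
by split=> pE; apply: nT; rewrite pE in Tp => //; exact: sT.
Qed.

End spanning.

(** * Hyperfinite forests up to null sets *)

Lemma forest_sub (d : measure_display) (J : measurableType d) (R : realType)
    (mu : probability J R) (E F F' : set (J * J)) :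
  gdata mu E -> measurable F -> sym_edges F -> F' `<=` E -> F `<=` F' ->
  forest mu F' -> forest mu F.
Proof.
move=> G mF sF F'E FF' [N [mN sN NF' N0 aN]].
have NE : N `<=` E by exact: subset_trans F'E.
have mI : measurable (F `&` N) by exact: measurableI.
exists (F `&` N); split=> //.
- by move=> x y [/sF ? /sN].
- have IE : F `&` N `<=` E by move=> p [_ /NE].
  have : (emeas G N <= 0)%E.
    move/eqP: N0; rewrite (edge_measE G)// mule_eq0 eqe invr_eq0 pnatr_eq0 /=.
    by move=> /eqP ->.
  rewrite (edge_measE G)// => N0'.
  suff -> : emeas G (F `&` N) = 0%E by rewrite mule0.
  apply/eqP; rewrite -measure_le0; apply: le_trans N0'.
  by apply: le_measure; rewrite ?inE.
- move=> n f [n3 inj edge]; apply: (aN n f); split=> // i il.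
  by have [Fi ni] := edge i il; split; [exact: FF'|move=> Ni; exact: ni].
Qed.

Lemma hyperfinite_sub (d : measure_display) (J : measurableType d) (R : realType)
    (mu : probability J R) (E F F' : set (J * J)) :
  gdata mu E -> measurable F -> sym_edges F -> F' `<=` E -> F `<=` F' ->
  hyperfinite mu F' -> hyperfinite mu F.
Proof.
move=> G mF sF F'E FF' hF' e e0; have [S [mS sS SF' eS fS]] := hF' e e0.
have SE : S `<=` E by exact: subset_trans F'E.
have mI : measurable (F `&` S) by exact: measurableI.
exists (F `&` S); split=> //.
- by move=> x y [/sF ? /sS].
- apply: le_trans eS; have IE : F `&` S `<=` E by move=> p [_ /SE].
  rewrite !(edge_measE G)//; apply: lee_wpmul2l; first by rewrite lee_fin invr_ge0.
  by apply: le_measure; rewrite ?inE.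
- move=> x; apply: sub_finite_set (fS x); apply: component_mono => p [Fp np].
  by split; [exact: FF'|move=> Sp; exact: np].
Qed.

Section null.
Context (d : measure_display) (J : measurableType d) (R : realType)
  (mu : probability J R) (E : set (J * J)) (G : gdata mu E).

(** The hub of the equivalences: [F] agrees, up to a null set, with an edge set satisfying all the
    invariants everywhere. *)
Definition near_good F := exists F0, [/\ good mu E F0, F0 `<=` F & emeas G (F `\` F0) = 0%E].

Section props.
Variable F : set (J * J).
Hypotheses (mF : measurable F) (sF : sym_edges F) (FE : F `<=` E).

Lemma near_good_forest : near_good F -> forest mu F.
Proof.
move=> [F0 [[mF0 sF0 F0E bF0 _] F0F N0]]; exists (F `\` F0); split.
- exact: measurableD.
- by move=> x y [/sF ? n]; split=> // /sF0.
- by move=> p [].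
- rewrite (edge_measE G) ?N0 ?mule0//; first exact: measurableD.
  by move=> p [/FE].
- rewrite setDD setIidr//; exact: bridges_acyclic.
Qed.

Lemma near_good_hyperfinite : near_good F -> hyperfinite mu F.
Proof.
move=> [F0 [[mF0 sF0 F0E _ [hF0 _]] F0F N0]] e e0.
have [S [mS sS SF eS fS]] := hF0 e e0.
have mD : measurable (F `\` F0) by exact: measurableD.
exists (S `|` (F `\` F0)); split.
- exact: measurableU.
- by move=> x y [/sS h|[/sF ? n]]; [left|right; split=> // /sF0].
- by move=> p [/SF/F0F|[]].
- have SE : S `<=` E by exact: subset_trans F0E.
  have UE : S `|` (F `\` F0) `<=` E by rewrite subUset; split=> // p [/FE].
  apply: le_trans eS; rewrite !(edge_measE G)//; last exact: measurableU.
  apply: lee_wpmul2l; first by rewrite lee_fin invr_ge0.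
  have := measureU2 (emeas G) mS mD; rewrite [X in (_ <= _ + X)%E -> _]N0 adde0.
  exact.
- move=> x; apply: sub_finite_set (fS x); apply: component_mono => p [Fp np].
  split; last by move=> Sp; apply: np; left.
  by apply: contrapT => nF; apply: np; right.
Qed.

Lemma emeas_diff0 F0 : measurable F0 -> F0 `<=` F -> emeas G (F `\` F0) = 0%E ->
  emeas G F0 = emeas G F.
Proof.
move=> mF0 F0F N0; rewrite -[in RHS](setDUK F0F) measureU//.
- by rewrite [X in (_ + X)%E]N0 adde0.
- exact: measurableD.
- exact: setDIK.
Qed.

Lemma near_good_rank : near_good F -> grank mu F = edge_meas mu F.
Proof.
move=> [F0 [[mF0 sF0 F0E _ [_ rF0]] F0F N0]].
rewrite (edge_measE G)// -(emeas_diff0 mF0 F0F N0) -(edge_measE G)// -rF0.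
apply: (grank_ae G) => //.
have mD : measurable (F `\` F0) by exact: measurableD.
have DE : F `\` F0 `<=` E by move=> p [/FE].
apply: filterS (ae_component_null mD DE N0) => x /(_ F FE) <-.
by rewrite setDD setIidr.
Qed.

Lemma good_diff0 T : good mu E T -> T `<=` F -> emeas G T = emeas G F ->
  emeas G (F `\` T) = 0%E.
Proof.
move=> [mT sT TE _ _] TF eT.
have := emeas_fin G mF FE; rewrite -eT => fT.
have := measureD mF mT (mu := emeas G); rewrite setIidr// => ->.
  by rewrite -[X in (X - _)%E]eT subee.
by rewrite ltey_eq emeas_fin.
Qed.

(** The set [T] grown inside [F] has the finite components of [F], hence its rank; as [T] also has
    equal rank and edge measure, its edge measure is that of [F]. *)
Lemma rank_near_good : grank mu F = edge_meas mu F -> near_good F.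
Proof.
move=> rF; have [T [gT _ TF spT]] := extend G mF sF FE (good0 G) (@sub0set _ _).
have [mT sT TE _ [_ rT]] := gT.
exists T; split=> //; apply: good_diff0 => //.
have : edge_meas mu T = edge_meas mu F.
  rewrite -rT -rF; apply: (grank_ae G) => //; apply: aeW => x.
  have [fx|nx] := pselect (finite_set (component T x)); first by rewrite spT.
  rewrite !inv_size_infinite// => fF; apply: nx.
  by apply: sub_finite_set fF; exact: component_mono.
rewrite !(edge_measE G)//.
have := emeas_fin G mF FE; have := emeas_fin G mT TE.
move: (emeas G T) (emeas G F) => [a| |]// [b| |]// _ _.
by rewrite -!EFinM => -[] /mulfI -> //; rewrite invr_eq0 pnatr_eq0.
Qed.

Lemma forest_near_good : forest mu F -> hyperfinite mu F -> near_good F.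
Proof.
move=> [N [mN sN NF N0 aN]] hF.
have NE : N `<=` E by exact: subset_trans FE.
(* Summable bounds on the cut sets, with a view to the Borel-Cantelli lemma. *)
have eps_gt0 k : 0 < 1 / (2 ^ k.+1)%:R :> R by rewrite divr_gt0 ?ltr0n ?expn_gt0.
have /choice[S SP] k := hF _ (eps_gt0 k).
have mS k : measurable (S k) by case: (SP k).
have SE k : S k `<=` E by case: (SP k) => _ _ h _ _; exact: subset_trans FE.
(* Removing all later cut sets as well makes [Fk] increasing. An edge missed by every [Fk k] lies in
   [N] or in infinitely many of the [S j]. *)
pose Fk k := (F `\` N) `\` \bigcup_(j >= k) S j.
have ndF i j : (i <= j)%N -> Fk i `<=` Fk j.
  by move=> ij p [Fp nS]; split=> // -[l /= jl Sl]; apply: nS; exists l => //=; exact: leq_trans jl.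
have gF k : good mu E (Fk k).
  apply: (good_finite_forest G).
  - by apply: measurableD; [exact: measurableD|apply: bigcup_measurable => j _].
  - move=> x y [[/sF Fxy nN] nS]; split; first by split=> // /sN.
    by move=> [j kj Sj]; apply: nS; exists j => //; case: (SP j) => _ + _ _ _; apply.
  - by move=> p [[/FE]].
  - apply: (@bridges_sub _ _ (F `\` N)); first by move=> p [].
    apply: acyclic_bridges => //; first by move=> x y [/sF ? n]; split=> // /sN.
    by move=> x [/FE Exx _]; exact: (graphing_irrefl G Exx).
  - move=> x; have [_ _ _ _ /(_ x)] := SP k; apply: sub_finite_set.
    apply: component_mono => p [[Fp _] nS]; split=> // Sp; apply: nS.
    by exists k => /=.
exists (\bigcup_k Fk k); split; first exact: (good_bigcup G).
  by move=> p [k _ [[]]].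
have L0 : emeas G (lim_sup_set S) = 0%E.
  apply: lim_sup_set_cvg0 => //.
  (* The numerator 2 converts the bound on the edge measure into one on [emeas]. *)
  apply: (@le_lt_trans _ _ (\sum_(k <oo) (2 / (2 ^ k.+1)%:R)%:E)%E); last first.
    by apply: (le_lt_trans (epsilon_trick0 xpredT _)); rewrite ?ltry.
  have h k : (emeas G (S k) <= (2 / (2 ^ k.+1)%:R)%:E)%E.
    case: (SP k) => _ _ _ + _.
    rewrite (edge_measE G)//; have := emeas_fin G (mS k) (@SE k).
    move: (emeas G (S k)) => [a| |]// _; rewrite -EFinM !lee_fin mul1r.
    by move: ((2 ^ k.+1)%:R^-1) => X h; lra.
  by apply: lee_nneseries => // k _; exact: h.
have mL : measurable (lim_sup_set S).
  by apply: bigcapT_measurable => k; apply: bigcup_measurable => j _.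
have N0' : emeas G N = 0%E.
  by move/eqP: N0; rewrite (edge_measE G)// mule_eq0 eqe invr_eq0 pnatr_eq0 /= => /eqP.
have NL0 : emeas G (N `|` lim_sup_set S) = 0%E.
  apply/eqP; rewrite -measure_le0.
  have := measureU2 (emeas G) mN mL.
  by rewrite [X in (_ <= X + _)%E -> _]N0' [X in (_ <= _ + X)%E -> _]L0 adde0.
apply: (subset_measure0 (mu := emeas G)) NL0.
- apply: measurableD => //; apply: bigcupT_measurable => k.
  by case: (gF k).
- exact: measurableU.
- move=> p [Fp nFk]; have [Np|nN] := pselect (N p); first by left.
  right => k _; apply: contrapT => nS; apply: nFk; exists k => //.
Qed.

End props.

(** Growing from [F0] inside [E] gives [T], which contains [F] only up to a null set. The forest is
    therefore [T] together with [F], and it still spans because it lies between [T] and [E]. *)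
Lemma near_good_extend F : measurable F -> sym_edges F -> F `<=` E -> near_good F ->
  exists F', [/\ measurable F', sym_edges F',
       ess_spanning_forest mu E F', hyperfinite mu F' & F `<=` F'].
Proof.
move=> mF sF FE [F0 [gF0 F0F N0]]; have [mF0 _ F0E _ _] := gF0.
have mE := graphing_measurable G.
have [T [gT F0T TE spT]] := extend G mE (graphing_sym G) (@subset_refl _ E) gF0 F0E.
have [mT sT _ _ _] := gT.
have mU : measurable (T `|` F) by exact: measurableU.
have UE : T `|` F `<=` E by rewrite subUset.
have sU : sym_edges (T `|` F) by move=> x y [/sT|/sF] h; [left|right].
have gU : near_good (T `|` F).
  exists T; split=> //; apply: (subset_measure0 (mu := emeas G)) N0.
  - exact: measurableD.
  - exact: measurableD.
  - by move=> p [[//|Fp] nT]; split=> // /F0T.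
exists (T `|` F); split=> //.
  split=> //; first exact: near_good_forest.
  apply: aeW => x; have TU : component T x `<=` component (T `|` F) x.
    by apply: component_mono => p Tp; left.
  split=> [fE|nE fU].
    apply/seteqP; split; first exact: component_mono.
    rewrite -spT//; apply: sub_finite_set fE; exact: component_mono.
  apply: nE; rewrite -spT; exact: sub_finite_set fU.
exact: near_good_hyperfinite.
Qed.

Lemma grank_spanning F : measurable F -> F `<=` E ->
  {ae mu, forall x,
         (finite_set (component E x) -> component F x = component E x) /\
         (~ finite_set (component E x) -> ~ finite_set (component F x))} ->
  grank mu F = grank mu E.
Proof.
move=> mF FE h; apply: (grank_ae G) => //; first exact: graphing_measurable G.
apply: filterS h => x [h1 h2].
have [fE|nE] := pselect (finite_set (component E x)); first by rewrite h1.
by rewrite !inv_size_infinite//; exact: h2.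
Qed.

(** Extend [F0] to a spanning [T]. Its edge measure is its rank, which is that of [E] and so equals
    the edge measure of [F0]; thus [T] adds only null edges, and [F0] spans almost everywhere. *)
Lemma rank_spanning F : measurable F -> sym_edges F -> F `<=` E ->
  grank mu F = edge_meas mu F -> edge_meas mu F = grank mu E ->
  ess_spanning_forest mu E F /\ hyperfinite mu F.
Proof.
move=> mF sF FE rF eF; have gF := rank_near_good mF sF FE rF.
split; last exact: near_good_hyperfinite.
split=> //; first exact: near_good_forest.
have [F0 [gF0 F0F N0]] := gF; have [mF0 _ F0E _ [_ rF0]] := gF0.
have mE := graphing_measurable G.
have [T [gT F0T TE spT]] := extend G mE (graphing_sym G) (@subset_refl _ E) gF0 F0E.
have [mT sT _ _ [_ rT]] := gT.
have rTE : grank mu T = grank mu E.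
  apply: grank_spanning => //; apply: aeW => x; split=> [fE|nE fT].
    by apply: spT; apply: sub_finite_set fE; exact: component_mono.
  by apply: nE; rewrite -spT.
have eTF : edge_meas mu F0 = edge_meas mu T.
  rewrite -rT rTE -eF !(edge_measE G)//; congr (_ * _)%E.
  exact: emeas_diff0.
have T0 : emeas G (T `\` F0) = 0%E.
  apply: good_diff0 => //; move: eTF; rewrite !(edge_measE G)//.
  have := emeas_fin G mF0 F0E; have := emeas_fin G mT TE.
  move: (emeas G T) (emeas G F0) => [a| |]// [b| |]// _ _.
  by rewrite -!EFinM => -[] /mulfI -> //; rewrite invr_eq0 pnatr_eq0.
have DE : T `\` F0 `<=` E by move=> p [/TE].
apply: filterS (ae_component_null (measurableD mT mF0) DE T0) => x /(_ T TE).
rewrite setDD setIidr// => F0x.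
have F0Fx : component F0 x `<=` component F x by exact: component_mono.
split=> [fE|nE fF].
  apply/seteqP; split; first exact: component_mono.
  rewrite -spT; first by rewrite -F0x.
  by apply: sub_finite_set fE; exact: component_mono.
apply: nE; rewrite -spT; last by rewrite -F0x; exact: sub_finite_set fF.
by rewrite -F0x; exact: sub_finite_set fF.
Qed.

End null.

Theorem theorem1p3 (d : measure_display) (J : measurableType d) (R : realType)
  (mu : probability J R) (E F : set (J * J)) :
  graphing mu E -> measurable F -> sym_edges F -> F `<=` E ->
  (* (i) <-> (ii) *)
  ((forest mu F /\ hyperfinite mu F) <->
   (exists F' : set (J * J), [/\ measurable F', sym_edges F',
       ess_spanning_forest mu E F', hyperfinite mu F' & F `<=` F'])) /\
  (* (ii) <-> (iii) *)
  ((exists F' : set (J * J), [/\ measurable F', sym_edges F',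
       ess_spanning_forest mu E F', hyperfinite mu F' & F `<=` F']) <->
   grank mu F = edge_meas mu F) /\
  (* (i') <-> (ii') *)
  ((ess_spanning_forest mu E F /\ hyperfinite mu F) <->
   (grank mu F = edge_meas mu F /\ edge_meas mu F = grank mu E)).
Proof.
move=> /graphing_gdata[G] mF sF FE.
have i_ng : forest mu F /\ hyperfinite mu F -> near_good G F.
  by move=> [fF hF]; exact: forest_near_good.
have ng_ii := @near_good_extend _ _ _ _ _ G F mF sF FE.
have ii_i : (exists F' : set (J * J), [/\ measurable F', sym_edges F',
    ess_spanning_forest mu E F', hyperfinite mu F' & F `<=` F']) ->
    forest mu F /\ hyperfinite mu F.
  move=> [F' [mF' sF' [F'E fF' _] hF' FF']].
  by split; [exact: forest_sub G mF sF F'E FF' fF'|exact: hyperfinite_sub G mF sF F'E FF' hF'].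
have iii_ng := @rank_near_good _ _ _ _ _ G F mF sF FE.
have ng_iii := @near_good_rank _ _ _ _ _ G F mF FE.
split; first by split=> [/i_ng/ng_ii|].
split; first by split=> [/ii_i/i_ng/ng_iii|/iii_ng/ng_ii].
split=> [[[_ fF sp] hF]|[rF eF]]; last exact: (rank_spanning G).
have rF := ng_iii (i_ng (conj fF hF)).
by split=> //; rewrite -rF; exact: (grank_spanning G).
Qed.
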